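(* Let $0<\alpha<1$, $\beta\ge0$ and $\eta>0$. Then $$\psi_{\alpha,\beta+\alpha\eta}(t,u)=\int_u^\infty g_\eta(s-u)\,\psi_{\alpha,\beta}(t,s)\,ds,\qquad t,u>0.$$
   Context: For $\gamma>0$, $g_\gamma(t):=t^{\gamma-1}/\Gamma(\gamma)$, $t>0$. Wright function: for $\lambda>-1$, $\mu\in\mathbb{C}$, $W_{\lambda,\mu}(z):=\sum_{n=0}^\infty \frac{z^n}{n!\,\Gamma(\lambda n+\mu)}$, $z\in\mathbb{C}$ (with $1/\Gamma=0$ at the poles of $\Gamma$). Scaled Wright function: for $0<\alpha<1$, $\beta\ge0$, $\psi_{\alpha,\beta}(t,s):=t^{\beta-1}W_{-\alpha,\beta}(-st^{-\alpha})$, $t>0$, $s\in\mathbb{C}$. *)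

(* Defs.v *)
From HB Require Import structures.
From mathcomp Require Import all_boot all_order all_algebra.
From mathcomp Require Import all_classical all_reals all_analysis.

Set Implicit Arguments.
Unset Strict Implicit.
Unset Printing Implicit Defensive.

Import Order.TTheory GRing.Theory Num.Theory.
Import numFieldNormedType.Exports.

Local Open Scope classical_set_scope.
Local Open Scope ring_scope.

Section Wright.
Context {R : realType}.

(* Euler's integral; it is the Gamma function for 0 < x only. *)
Definition eulerGamma (x : R) : R :=
  Rintegral (@lebesgue_measure R) `]0, +oo[
    (fun t => t `^ (x - 1) * expR (- t)).

(* Extension to the whole real line by the functional equation
   Gamma(x) = Gamma(x + n) / (x (x + 1) ... (x + n - 1)), for the least n such
   that 0 < x + n.  At a pole (x = 0, -1, -2, ...) the product vanishes; as
   0^-1 = 0, both Gamma x and (Gamma x)^-1 are then 0, so that (Gamma x)^-1 is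
   the usual entire function 1/Gamma at every real x. *)
Definition Gamma (x : R) : R :=
  let n := Num.truncn (1 - x) in
  eulerGamma (x + n%:R) / \prod_(k < n) (x + k%:R).

Definition g (gamma t : R) : R := t `^ (gamma - 1) / Gamma gamma.

(* Real parameters and real argument; the series converges when -1 < lambda. *)
Definition Wright (lambda mu z : R) : R :=
  limn (series (fun n : nat =>
    z ^+ n / n`!%:R * (Gamma (lambda * n%:R + mu))^-1)).

Definition psi (alpha beta t s : R) : R :=
  t `^ (beta - 1) * Wright (- alpha) beta (- s * t `^ (- alpha)).

End Wright.

(* Main.v *)
Require Import Defs.
From HB Require Import structures.
From mathcomp Require Import all_boot all_order all_algebra.
From mathcomp Require Import all_classical all_reals all_analysis.
From mathcomp Require Import measurable_realfun ring lra.

Set Implicit Arguments.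
Unset Strict Implicit.
Unset Printing Implicit Defensive.

Import Order.TTheory GRing.Theory Num.Theory.
Import numFieldNormedType.Exports.

Local Open Scope classical_set_scope.
Local Open Scope ring_scope.

(** Put F_b(y) = Wright (-alpha) b (-y) = sum_n (-y)^n / (n! Gamma(b - alpha n)), so
that psi alpha b t s = t^(b-1) F_b(s t^-alpha).  Up to powers of t, the theorem
says that the integral of g_eta(v) F_beta(x + v) over v > 0 is
F_(beta + alpha eta)(x).  This is clear once F_b is a superposition of
exponentials: Hankel's formula for 1/Gamma suggests

  F_b(y) = (2 pi i)^-1 int z^-b exp(z - y z^alpha) dz

over a Hankel contour, and the integral of g_eta(v) exp(-(x+v) z^alpha) is
z^(-alpha eta) exp(-x z^alpha), which turns b into b + alpha eta.

The contour is folded onto the single ray arg z = th, where pi/2 < th < pi and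
alpha th < pi/2, so that both exp(z) and exp(-y z^alpha) are bounded on it.  To
reach the origin in spite of z^-b, the Taylor polynomial T_N of exp with N terms
is subtracted from exp(z), for any N > b - 1; the two conjugate rays then give

  F_b(y) = pi^-1 int_0^oo Im (e^(i th) z^-b (exp(z) - T_N(z)) exp(-y z^alpha)) dr,
  z = r e^(i th),

which is [Wright_ray_kernel].  The choice of N is immaterial: one more term
changes the integral by a multiple of that of z^(N-b) exp(-y z^alpha) along the
ray, which equals the integral along the positive real axis and so is real.  Given
this formula, the theorem is one application of Fubini's theorem and one rotated
Gamma integral ([Int_frac_ray_kernel]), followed by a translation.

Everything is done with real integrals, the imaginary parts being written out.
Cauchy's theorem for a sector becomes [Int_constant_rate]: in polar coordinates
the derivative of the integrand in the angle is the derivative in r of another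
function, so that the integral varies with the angle at a rate given by the
boundary values of that function.

The ray formula itself ([cvg_wright]) has three cases.  For b < 1 one expands
exp(-y z^alpha) and integrates term by term, using 1/Gamma(mu) as an integral
over the ray ([Int_invGamma]); rotated to the negative real axis, that integral is
Euler's reflection formula, which is proved first.  For b = 1 the term n = 0 is set apart; it is
compensated by a Frullani integral.  For b > 1 both sides satisfy

  (b - 1) F_b(y) = F_(b-1)(y) - alpha y F_(b-alpha)(y),

the series by the functional equation of Gamma and the integral by parts; hence
an induction on the number of steps of length alpha needed to get below 1. *)

(** * Lebesgue integrals over the positive half-line *)

Section MeasurableComp.
Context d (T : measurableType d) {R : realType}.
Implicit Types (a : T -> R) (D : set T).

Lemma measurable_powR_comp D a p :
  measurable_fun D a -> measurable_fun D (fun x => a x `^ p).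
Proof. exact: measurableT_comp (@measurable_powR R p). Qed.

Lemma measurable_expR_comp D a :
  measurable_fun D a -> measurable_fun D (fun x => expR (a x)).
Proof. exact: measurableT_comp (@measurable_expR R). Qed.

Lemma measurable_sin_comp D a :
  measurable_fun D a -> measurable_fun D (fun x => sin (a x)).
Proof.
exact: measurableT_comp (continuous_measurable_fun (@continuous_sin R)).
Qed.

Lemma measurable_cos_comp D a :
  measurable_fun D a -> measurable_fun D (fun x => cos (a x)).
Proof.
exact: measurableT_comp (continuous_measurable_fun (@continuous_cos R)).
Qed.

End MeasurableComp.

(** Syntax-directed measurability of expressions built from the operations
used below.  Unification alone does not find the operands under the binder, hence
the explicit higher-order patterns. *)
Ltac meas := repeat match goal with
  | |- measurable_fun _ (fun _ => ?a) => apply: measurable_cst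
  | |- measurable_fun _ (fun x => x) => apply: measurable_id
  | |- measurable_fun _ (fun x => x.1) => apply: measurable_fst
  | |- measurable_fun _ (fun x => x.2) => apply: measurable_snd
  | |- measurable_fun _ (fun x => @?a x - @?b x) => apply: (@measurable_funB _ _ _ _ a b)
  | |- measurable_fun _ (fun x => @?a x + @?b x) => apply: (@measurable_funD _ _ _ _ a b)
  | |- measurable_fun _ (fun x => - @?a x) => apply: (@measurable_funN _ _ _ _ a)
  | |- measurable_fun _ (fun x => @?a x * @?b x) => apply: (@measurable_funM _ _ _ _ a b)
  | |- measurable_fun _ (fun x => @?a x ^+ ?n) => apply: (@measurable_funX _ _ _ _ a n)
  | |- measurable_fun _ (fun x => @?a x `^ ?p) => apply: (@measurable_powR_comp _ _ _ _ a p)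
  | |- measurable_fun _ (fun x => expR (@?a x)) => apply: (@measurable_expR_comp _ _ _ _ a)
  | |- measurable_fun _ (fun x => sin (@?a x)) => apply: (@measurable_sin_comp _ _ _ _ a)
  | |- measurable_fun _ (fun x => cos (@?a x)) => apply: (@measurable_cos_comp _ _ _ _ a)
  | |- measurable_fun _ (fun x => \sum_(i < _) _) => apply: measurable_sum => ?
  end.

Section HalfLine.
Context {R : realType}.
Implicit Types f g F : R -> R.
Local Notation mu := (@lebesgue_measure R).
Local Notation pos := (`]0, +oo[%classic : set R).

Definition L1 f := mu.-integrable pos (EFin \o f).
Definition Int f : R := Rintegral mu pos f.

Lemma posP x : pos x <-> 0 < x.
Proof. by rewrite /= in_itv/= andbT. Qed.

Lemma mpos : @measurable _ (measurableTypeR R) pos.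
Proof. exact: measurable_itv. Qed.
Hint Resolve mpos : core.

(** Global measurability of [f] is asked for, rather than measurability on the
half-line, because it is what [meas] establishes without side conditions. *)
Lemma L1_dom f g : measurable_fun setT f -> (forall x : R, 0 < x -> `|f x| <= g x) ->
  L1 g -> L1 f.
Proof.
move=> mf fg; apply: le_integrable => //.
  by apply/measurable_EFinP; exact: measurable_funTS.
move=> x /posP x0; rewrite /= lee_fin (le_trans (fg _ x0))//; exact: ler_norm.
Qed.

Lemma L1_ext f g : (forall x : R, 0 < x -> f x = g x) -> L1 f -> L1 g.
Proof.
move=> fg; apply: eq_integrable => // x; rewrite inE => /posP x0.
by rewrite /= fg.
Qed.

Lemma Int_ext f g : (forall x : R, 0 < x -> f x = g x) -> Int f = Int g.
Proof.
by move=> fg; apply: eq_Rintegral => x; rewrite inE => /posP x0; rewrite fg.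
Qed.

Lemma L1D f g : L1 f -> L1 g -> L1 (fun x => f x + g x).
Proof. by move=> lf lg; apply: (eq_integrable mpos) (integrableD mpos lf lg). Qed.

Lemma L1B f g : L1 f -> L1 g -> L1 (fun x => f x - g x).
Proof. by move=> lf lg; apply: (eq_integrable mpos) (integrableB mpos lf lg). Qed.

Lemma L1Z k f : L1 f -> L1 (fun x => k * f x).
Proof. by move=> lf; apply: (eq_integrable mpos) (integrableZl mpos k lf). Qed.

Lemma L1N f : L1 f -> L1 (fun x => - f x).
Proof. by move=> lf; apply: L1_ext (L1Z (-1) lf) => x _; rewrite mulN1r. Qed.

Lemma IntD f g : L1 f -> L1 g -> Int (fun x => f x + g x) = Int f + Int g.
Proof. by move=> lf lg; exact: RintegralD. Qed.

Lemma IntB f g : L1 f -> L1 g -> Int (fun x => f x - g x) = Int f - Int g.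
Proof. by move=> lf lg; exact: RintegralB. Qed.

Lemma IntZ k f : L1 f -> Int (fun x => k * f x) = k * Int f.
Proof. by move=> lf; exact: RintegralZl. Qed.

Lemma IntDZ a c (f h : R -> R) : L1 f -> L1 h ->
  Int (fun x => a * f x + c * h x) = a * Int f + c * Int h.
Proof. by move=> lf lh; rewrite (IntD (L1Z a lf) (L1Z c lh)) (IntZ a lf) (IntZ c lh). Qed.

Lemma Int_le f g : L1 f -> L1 g -> (forall x : R, 0 < x -> f x <= g x) ->
  Int f <= Int g.
Proof.
by move=> lf lg fg; apply: le_Rintegral => // x /posP x0; exact: fg.
Qed.

Lemma Int_ge0 f : (forall x : R, 0 < x -> 0 <= f x) -> 0 <= Int f.
Proof. by move=> f0; apply: Rintegral_ge0 => x /posP x0; exact: f0. Qed.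

Lemma IntE f : L1 f -> (\int[mu]_(x in pos) (f x)%:E = (Int f)%:E)%E.
Proof. by move=> lf; rewrite /Int /Rintegral fineK//; exact: integrable_fin_num. Qed.

Lemma L1_sum n (h : nat -> R -> R) : (forall i, (i < n)%N -> L1 (h i)) ->
  L1 (fun x => \sum_(i < n) h i x) /\
  Int (fun x => \sum_(i < n) h i x) = \sum_(i < n) Int (h i).
Proof.
elim: n => [|n IH] hL.
  have L0 : L1 (cst 0) by exact: integrable0.
  split; last first.
    rewrite big_ord0 -[RHS](mul0r (Int (cst 0))) -IntZ//.
    by apply: Int_ext => x _; rewrite big_ord0 mul0r.
  by apply: L1_ext L0 => x _; rewrite big_ord0.
have [L E] := IH (fun i lin => hL i (ltnW lin)).
have Ln := hL n (ltnSn _).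
split; first by apply: L1_ext (L1D L Ln) => x _; rewrite big_ord_recr.
rewrite big_ord_recr/= -E -IntD//.
by apply: Int_ext => x _; rewrite big_ord_recr.
Qed.

(** Dominated convergence.  The domination and the limit are required at every
point, which spares the almost-everywhere quantifiers. *)
Lemma Int_dct (f_ : nat -> R -> R) f g :
  (forall n, measurable_fun setT (f_ n)) -> measurable_fun setT f ->
  L1 g -> (forall n x, 0 < x -> `|f_ n x| <= g x) ->
  (forall x : R, 0 < x -> f_ n x @[n --> \oo] --> f x) ->
  L1 f /\ Int (f_ n) @[n --> \oo] --> Int f.
Proof.
move=> mf_ mf lg fg cf.
have [||||lf _ cvf] := @dominated_convergence _ _ R mu pos mpos
  (fun n x => (f_ n x)%:E) (fun x => (f x)%:E) (EFin \o g) _ _ _ lg.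
- by move=> n; apply/measurable_EFinP; exact: measurable_funTS (mf_ n).
- by apply/measurable_EFinP; exact: measurable_funTS mf.
- apply: aeW => x /posP x0; apply: cvg_EFin; first exact: nearW.
  exact: cf.
- by apply: aeW => x n /posP x0; rewrite lee_fin; exact: fg.
- split=> //; apply/fine_cvg; move: cvf; rewrite IntE//.
Qed.

(** Compact intervals exhausting the half-line, on which the fundamental theorem
of calculus for continuous integrands applies. *)
Let J (n : nat) : set R := `[n.+1%:R^-1, n.+2%:R]%classic.

Let J_pos n x : J n x -> 0 < x.
Proof.
by rewrite /J/= in_itv/= => /andP[+ _]; apply: lt_le_trans; rewrite invr_gt0 ltr0n.
Qed.

Let J_near x : 0 < x -> \forall n \near \oo, J n x.
Proof.
move=> x0; near=> n; rewrite /J/= in_itv/=; apply/andP; split.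
  rewrite -[leRHS]invrK lef_pV2 ?posrE ?invr_gt0 ?ltr0n//.
  near: n; have := nbhs_infty_ger (x^-1); apply: filterS => n /le_trans; apply.
  by rewrite ler_nat.
near: n; have := nbhs_infty_ger x; apply: filterS => n /le_trans; apply.
by rewrite ler_nat (leq_trans (leqnSn _)).
Unshelve. all: by end_near. Qed.

Let FTC_J F f n : (forall x : R, 0 < x -> is_derive x 1 F (f x)) ->
  (forall x : R, 0 < x -> {for x, continuous f}) ->
  (\int[mu]_(x in J n) (f x)%:E = (F n.+2%:R)%:E - (F n.+1%:R^-1)%:E)%E.
Proof.
move=> dF cf.
have J0 x : n.+1%:R^-1 <= x -> 0 < x.
  by apply: lt_le_trans; rewrite invr_gt0 ltr0n.
have ab : n.+1%:R^-1 < n.+2%:R :> R.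
  by rewrite (@le_lt_trans _ _ 1) ?ltr1n// invf_le1 ?ler1n ?ltr0n.
have cF x : 0 < x -> {for x, continuous F}.
  move=> x0; apply: differentiable_continuous; apply/derivable1_diffP.
  by have [] := dF x x0.
apply: (continuous_FTC2 ab).
- apply: continuous_in_subspaceT => x; rewrite inE/= in_itv/= => /andP[/J0 x0 _].
  exact: cf.
- split.
  + by move=> x; rewrite in_itv/= => /andP[/ltW/J0 x0 _]; have [] := dF x x0.
  + by apply: cvg_at_right_filter; apply: cF; exact: J0.
  + by apply: cvg_at_left_filter; apply: cF; apply: J0; exact: ltW.
- move=> x; rewrite in_itv/= => /andP[/ltW/J0 x0 _]; rewrite derive1E.
  by have dFx := dF x x0; rewrite derive_val.
Qed.

Let cvgF_J F (A B : R) : F x @[x --> 0^'+] --> A -> F x @[x --> +oo] --> B ->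
  F n.+2%:R - F n.+1%:R^-1 @[n --> \oo] --> B - A.
Proof.
move=> FA FB; apply: cvgB.
  move/cvg_pinftyP : FB; apply; apply/cvgryPge => r; near=> n.
  rewrite (@le_trans _ _ n%:R)//; last by rewrite ler_nat (leq_trans (leqnSn _)).
  by near: n; exact: nbhs_infty_ger.
move/cvg_at_rightP : FA; apply; split; first by move=> n; rewrite invr_gt0 ltr0n.
exact: cvg_harmonic.
Unshelve. all: by end_near. Qed.

(** For a nonnegative integrand integrability comes for free, by monotone
convergence along the exhaustion by the intervals [J n]. *)
Lemma ge0_FTC_pos F f (A B : R) : measurable_fun setT f ->
  (forall x : R, 0 < x -> 0 <= f x) ->
  (forall x : R, 0 < x -> is_derive x 1 F (f x)) ->
  (forall x : R, 0 < x -> {for x, continuous f}) ->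
  F x @[x --> 0^'+] --> A -> F x @[x --> +oo] --> B ->
  L1 f /\ Int f = B - A.
Proof.
move=> mf f0 dF cf FA FB.
have JU : \bigcup_n J n = pos.
  apply/seteqP; split=> [x [n _ /J_pos x0]|x /posP x0]; first exact/posP.
  have [n _ /(_ n (leqnn _))] := J_near x0; by exists n.
have E : (\int[mu]_(x in pos) (f x)%:E = (B - A)%:E)%E.
  rewrite -JU; have H := @ge0_nondecreasing_set_cvg_integral _ (measurableTypeR R)
    R J (fun x => (f x)%:E) mu.
  have C2 : (\int[mu]_(x in J i) (f x)%:E)%E @[i --> \oo] --> (B - A)%:E.
    rewrite (_ : (fun i => _) = (fun n => (F n.+2%:R - F n.+1%:R^-1)%:E)).
      by apply: cvg_EFin; [exact: nearW|exact: cvgF_J].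
    by apply/funext => n; rewrite (FTC_J _ dF cf).
  apply: cvg_unique C2 => //; apply: H.
  - move=> m n mn; apply/subsetPset => x; rewrite /J/= !in_itv/= => /andP[a b].
    apply/andP; split.
      by apply: le_trans a; rewrite lef_pV2 ?posrE ?ltr0n// ler_nat.
    by apply: (le_trans b); rewrite ler_nat.
  - by move=> i; exact: measurable_itv.
  - by move=> i; apply/measurable_EFinP; exact: measurable_funTS mf.
  - by move=> i x /J_pos x0; rewrite lee_fin f0.
split; last by rewrite /Int /Rintegral E.
apply/integrableP; split; first by apply/measurable_EFinP; exact: measurable_funTS mf.
suff -> : (\int[mu]_(x in pos) `|(EFin \o f) x| = \int[mu]_(x in pos) (f x)%:E)%E.
  by rewrite E ltry.
by apply: eq_integral => x; rewrite inE => /posP x0 /=; rewrite ger0_norm// f0.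
Qed.

(** Truncating [f] to [J n] is dominated by [f], so the integrals over [J n]
converge to the integral; they also converge to the difference of the limits. *)
Lemma FTC_pos F f (A B : R) : measurable_fun setT f -> L1 f ->
  (forall x : R, 0 < x -> is_derive x 1 F (f x)) ->
  (forall x : R, 0 < x -> {for x, continuous f}) ->
  F x @[x --> 0^'+] --> A -> F x @[x --> +oo] --> B ->
  Int f = B - A.
Proof.
move=> mf lf dF cf FA FB.
have [||||_] := @Int_dct (fun n x => f x * \1_(J n) x) f (fun x => `|f x|) _ mf _ _ _.
- by move=> n; apply: measurable_funM => //; apply: measurable_indic; exact: measurable_itv.
- exact: (integrable_abse lf).
- move=> n x _; rewrite normrM ler_piMr// indicE.
  by case: (_ \in _); rewrite ?normr1 ?normr0.
- move=> x x0; apply: cvg_near_cst; near=> n.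
  rewrite indicE mem_set ?mulr1//; near: n; exact: J_near.
move=> H; apply: (cvg_unique _ H) => //.
rewrite (_ : (fun n => _) = (fun n => F n.+2%:R - F n.+1%:R^-1)); first exact: cvgF_J.
apply/funext => n; rewrite -[RHS]/(fine ((F n.+2%:R)%:E - (F n.+1%:R^-1)%:E)%E).
rewrite -(FTC_J _ dF cf) /Int /Rintegral; congr fine.
transitivity (\int[mu]_(x in pos) ((fun x => (f x)%:E) \_ (J n)) x)%E.
  apply: eq_integral => x _; rewrite patchE indicE.
  by case: (x \in J n); rewrite ?mulr1 ?mulr0.
rewrite -integral_mkcondr; congr (integral _ _ _).
by apply/setIidPr => x /J_pos/posP.
Unshelve. all: by end_near. Qed.

(** The product theorems are about whole spaces: the half-line is encoded by
multiplying with its indicator. *)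
Let ipos (x : R) : R := \1_pos x.

Let ipos1 x : 0 < x -> ipos x = 1.
Proof. by move=> /posP x0; rewrite /ipos indicE mem_set. Qed.

Let ipos0 x : ~ 0 < x -> ipos x = 0.
Proof. by move=> x0; rewrite /ipos indicE memNset// => /posP. Qed.

Let integral_ipos f :
  (\int[mu]_x (f x * ipos x)%:E = \int[mu]_(x in pos) (f x)%:E)%E.
Proof.
rewrite [RHS]integral_mkcond; apply: eq_integral => x _.
by rewrite patchE /ipos indicE; case: (x \in pos); rewrite ?mulr1 ?mulr0.
Qed.

(** Integrability on the product is obtained from Tonelli's theorem, through the
bound [G] on the absolute integrals in the first variable. *)
Lemma Fubini_pos (f : R -> R -> R) (G : R -> R) :
  measurable_fun setT (fun z : R * R => f z.1 z.2) -> L1 G ->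
  (forall x : R, 0 < x -> L1 (f x)) ->
  (forall y : R, 0 < y -> L1 (f ^~ y)) ->
  (forall y : R, 0 < y -> Int (fun x => `|f x y|) <= G y) ->
  L1 (fun x => Int (f x)) /\
  Int (fun x => Int (f x)) = Int (fun y => Int (f ^~ y)).
Proof.
move=> mf lG lf lf' fG.
pose m := (@lebesgue_measure R : {sigma_finite_measure set (measurableTypeR R) -> \bar R}).
pose h (z : measurableTypeR R * measurableTypeR R) : \bar R :=
  (f z.1 z.2 * ipos z.2 * ipos z.1)%:E.
have mi : measurable_fun setT ipos by apply: measurable_indic; exact: mpos.
have mh : measurable_fun setT h.
  apply/measurable_EFinP; apply: measurable_funM.
    apply: measurable_funM; first exact: mf.
    exact: (measurableT_comp mi measurable_snd).
  exact: (measurableT_comp mi measurable_fst).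
have h1E x : (\int[m]_y h (x, y) = (Int (f x) * ipos x)%:E)%E.
  have [x0|x0] := pselect (0 < x); last first.
    rewrite (ipos0 x0) mulr0 integral0_eq// => y _.
    by rewrite /h/= (ipos0 x0) mulr0.
  rewrite (ipos1 x0) mulr1 -(IntE (lf _ x0)) -integral_ipos.
  by apply: eq_integral => y _; rewrite /h/= (ipos1 x0) mulr1.
have h2E y : (\int[m]_x h (x, y) = (Int (f ^~ y) * ipos y)%:E)%E.
  have [y0|y0] := pselect (0 < y); last first.
    rewrite (ipos0 y0) mulr0 integral0_eq// => x _.
    by rewrite /h/= (ipos0 y0) mulr0 mul0r.
  rewrite (ipos1 y0) mulr1 -(IntE (lf' _ y0)) -integral_ipos.
  by apply: eq_integral => x _; rewrite /h/= (ipos1 y0) mulr1.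
have h3E y : (\int[m]_x `|h (x, y)| = (Int (fun x => `|f x y|) * ipos y)%:E)%E.
  have [y0|y0] := pselect (0 < y); last first.
    rewrite (ipos0 y0) mulr0 integral0_eq// => x _.
    by rewrite /h/= (ipos0 y0) mulr0 mul0r normr0.
  rewrite (ipos1 y0) mulr1 -(IntE (integrable_abse (lf' _ y0))).
  rewrite -integral_ipos; apply: eq_integral => x _.
  rewrite /h/= (ipos1 y0) mulr1 normrM; congr (_ * _)%:E.
  by rewrite ger0_norm// /ipos indicE.
(* Measurability of the absolute section integrals is needed to compare them with G. *)
have mF : measurable_fun setT (fun y => \int[m]_x `|h (x, y)|)%E.
  apply: (measurable_fun_fubini_tonelli_G (abse \o h)).
    exact: measurableT_comp.
  by move=> x; exact: abse_ge0.
have ih : (m \x m)%E.-integrable setT h.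
  apply/(integrable21ltyP m m mh).
  under eq_integral do rewrite h3E.
  rewrite integral_ipos.
  apply: (@le_lt_trans _ _ (\int[mu]_(x in pos) `|(G x)%:E|)%E); last first.
    by have /integrableP[] := lG.
  apply: ge0_le_integral; first exact: mpos.
  - by move=> x _; rewrite lee_fin Int_ge0.
  - apply: eq_measurable_fun (measurable_funTS mF) => y.
    by rewrite inE => /posP y0; rewrite h3E (ipos1 y0) mulr1.
  - by apply: measurableT_comp => //; have /integrableP[] := lG.
  - by move=> x /posP x0; rewrite lee_fin (le_trans (fG _ x0))// ler_norm.
have iF := integrable_fubini_F ih.
have Fub := Fubini ih.
split.
  apply: (@L1_ext (fun x => Int (f x) * ipos x)).
    by move=> x x0; rewrite (ipos1 x0) mulr1.
  have iF' : m.-integrable pos (fubini_F m h).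
    exact: (integrableS measurableT mpos (@subsetT _ _) iF).
  by apply: (eq_integrable mpos) iF' => x _; exact: h1E.
rewrite /Int /Rintegral; congr fine; rewrite -!integral_ipos.
transitivity (\int[m]_x \int[m]_y h (x, y))%E.
  by apply: eq_integral => x _; rewrite h1E.
by rewrite Fub; apply: eq_integral => y _; rewrite h2E.
Qed.
End HalfLine.

(** * Differentiation of explicit expressions *)

Section DerivativeRules.
Context {R : realType}.
Implicit Types (a b : R -> R) (x da db : R).

(** The rules of differentiation for functions given by an explicit lambda, the
form that the tactic [der] matches. *)
Lemma is_derive_cst_fun (k : R) x : is_derive x 1 (fun _ : R => k) 0.
Proof. exact: is_derive_cst. Qed.

Lemma is_derive_id_fun x : is_derive x 1 (fun y : R => y) 1.
Proof. exact: is_derive_id. Qed.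

Lemma is_deriveD_fun a b x da db : is_derive x 1 a da -> is_derive x 1 b db ->
  is_derive x 1 (fun y => a y + b y) (da + db).
Proof. by move=> ? ?; exact: is_deriveD. Qed.

Lemma is_deriveN_fun a x da : is_derive x 1 a da ->
  is_derive x 1 (fun y => - a y) (- da).
Proof. by move=> ?; exact: is_deriveN. Qed.

Lemma is_deriveM_fun a b x da db : is_derive x 1 a da -> is_derive x 1 b db ->
  is_derive x 1 (fun y => a y * b y) (a x * db + b x * da).
Proof. by move=> ? ?; exact: is_deriveM. Qed.

Lemma is_derive_expR_fun a x da : is_derive x 1 a da ->
  is_derive x 1 (fun y => expR (a y)) (expR (a x) * da).
Proof. by move=> ?; exact: (@is_derive1_comp _ expR a). Qed.

Lemma is_derive_sin_fun a x da : is_derive x 1 a da ->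
  is_derive x 1 (fun y => sin (a y)) (cos (a x) * da).
Proof. by move=> ?; exact: (@is_derive1_comp _ sin a). Qed.

Lemma is_derive_cos_fun a x da : is_derive x 1 a da ->
  is_derive x 1 (fun y => cos (a y)) (- sin (a x) * da).
Proof. by move=> ?; exact: (@is_derive1_comp _ cos a). Qed.

Lemma is_derive_powR_fun a (p : R) x da : 0 < a x -> is_derive x 1 a da ->
  is_derive x 1 (fun y => a y `^ p) (p * a x `^ (p - 1) * da).
Proof.
by move=> ax0 ?; apply: (@is_derive1_comp _ (fun y => y `^ p) a); exact: is_derive1_powR.
Qed.

Lemma is_derive_continuous a x da : is_derive x 1 a da -> {for x, continuous a}.
Proof.
move=> [d _]; apply: differentiable_continuous; exact/derivable1_diffP.
Qed.

End DerivativeRules.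

(** Computes a derivative by following the syntax of the function; the derivative
is an existential variable that gets instantiated on the way.  Side conditions
(positivity of the base of a real power) are left over. *)
Ltac der := repeat match goal with
  | H : is_derive ?x 1 ?f _ |- is_derive ?x 1 ?f _ => exact: H
  | |- is_derive _ _ (fun _ => ?k) _ => notypeclasses refine (@is_derive_cst_fun _ k _)
  | |- is_derive _ _ (fun y => y) _ => notypeclasses refine (@is_derive_id_fun _ _)
  | |- is_derive _ _ (fun y => @?a y + @?b y) _ =>
      notypeclasses refine (@is_deriveD_fun _ a b _ _ _ _ _)
  | |- is_derive _ _ (fun y => - @?a y) _ =>
      notypeclasses refine (@is_deriveN_fun _ a _ _ _)
  | |- is_derive _ _ (fun y => @?a y * @?b y) _ =>
      notypeclasses refine (@is_deriveM_fun _ a b _ _ _ _ _)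
  | |- is_derive _ _ (fun y => expR (@?a y)) _ =>
      notypeclasses refine (@is_derive_expR_fun _ a _ _ _)
  | |- is_derive _ _ (fun y => sin (@?a y)) _ =>
      notypeclasses refine (@is_derive_sin_fun _ a _ _ _)
  | |- is_derive _ _ (fun y => cos (@?a y)) _ =>
      notypeclasses refine (@is_derive_cos_fun _ a _ _ _)
  | |- is_derive _ _ (fun y => @?a y `^ ?p) _ =>
      notypeclasses refine (@is_derive_powR_fun _ a p _ _ _ _)
  end.
Ltac derive_by tac := notypeclasses refine (is_derive_eq _ _); [der; try done | cbv beta; tac].
(** Continuity at a point, as a consequence of differentiability. *)
Ltac conti := notypeclasses refine (is_derive_continuous _); der; try done.

(** * Integrals of powers against stretched exponentials, and rotation of the ray *)

Section PowExp.
Context {R : realType}.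
Implicit Types q p a c s x r : R.

(** A real power is below 1 + x^k for an integer k above the exponent, and x^k is
a term of the exponential series, up to k!. *)
Lemma powR_le_expR s : 0 <= s ->
  exists2 C, 0 <= C & forall x, 0 <= x -> x `^ s <= C * expR x.
Proof.
move=> s0; pose k := (Num.truncn s).+1.
have sk : s <= k%:R by exact: ltW (truncnS_gt _).
(* 1 takes care of x <= 1 and k! of x > 1. *)
exists (1 + k`!%:R); first by rewrite addr_ge0.
move=> x x0.
have ex1 : 1 <= expR x by rewrite -expR0 ler_expR.
have xk : x ^+ k <= k`!%:R * expR x.
  have := @expR_ge1Dxn R x k.-1 x0; rewrite /k/= => H.
  rewrite mulrC -ler_pdivrMr ?ltr0n ?fact_gt0//.
  by apply: le_trans H; rewrite lerDr.
have : x `^ s <= 1 + x ^+ k.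
  have [x1|x1] := leP x 1.
    rewrite (@le_trans _ _ 1)// ?lerDl ?exprn_ge0//.
    have <- : 1 `^ s = 1 :> R by rewrite powR1.
    by apply: ge0_ler_powR; rewrite ?nnegrE.
  rewrite -powR_mulrn// (@le_trans _ _ (x `^ k%:R))// ?lerDr//.
  by apply: ler_powR => //; exact: ltW.
by move=> /le_trans; apply; rewrite mulrDl mul1r lerD.
Qed.

Lemma powRexp_bounded q p a : 0 <= q -> 0 < p -> 0 < a ->
  exists2 C, 0 <= C & forall r, 0 < r -> r `^ q * expR (- (p * r `^ a)) <= C.
Proof.
move=> q0 p0 a0; have [C C0 HC] := powR_le_expR (divr_ge0 q0 (ltW a0)).
exists (C / p `^ (q / a)); first by rewrite divr_ge0 ?powR_ge0.
move=> r r0; rewrite expRN ler_pdivrMr ?expR_gt0// mulrAC ler_pdivlMr ?powR_gt0//.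
have := HC (p * r `^ a) _; rewrite powRM ?powR_ge0 ?(ltW p0)//.
rewrite -powRrM mulrCA divff ?gt_eqF// mulr1 (mulrC (p `^ _)); apply.
by rewrite mulr_ge0 ?powR_ge0 ?ltW.
Qed.

Lemma powR_cvgy q : 0 < q -> r `^ q @[r --> +oo] --> +oo.
Proof.
move=> q0; apply/cvgryPge => A; near=> r.
have r0 : 0 <= r by near: r; exact: nbhs_pinfty_ge.
apply: (@le_trans _ _ (Num.max A 1)); first by rewrite le_max lexx.
have m0 : 0 <= Num.max A 1 by rewrite le_max ler01 orbT.
have {1}-> : Num.max A 1 = (Num.max A 1 `^ q^-1) `^ q.
  by rewrite -powRrM mulVf ?gt_eqF// powRr1.
apply: ge0_ler_powR; rewrite ?nnegrE ?powR_ge0 ?(ltW q0)//.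
Unshelve. all: by end_near. Qed.

Lemma powRexp_cvgy q p a : 0 <= q -> 0 < p -> 0 < a ->
  r `^ q * expR (- (p * r `^ a)) @[r --> +oo] --> (0 : R).
Proof.
move=> q0 p0 a0; have [C C0 HC] := powRexp_bounded (addr_ge0 q0 ler01) p0 a0.
apply: (@squeeze_cvgr _ _ _ _ (cst 0) (fun r => C * r^-1)).
- near=> r; have r0 : 0 < r by near: r; exact: nbhs_pinfty_gt.
  rewrite mulr_ge0 ?powR_ge0 ?expR_ge0//= ler_pdivlMr// mulrC mulrA.
  have := HC _ r0; rewrite powRD ?(gt_eqF r0) ?implybT// powRr1 ?(ltW r0)//.
  by rewrite [r `^ q * r]mulrC.
- exact: cvg_cst.
- rewrite -(mulr0 C); apply: cvgMl_tmp.
  by apply/gtr0_cvgV0 => //; exact: nbhs_pinfty_gt.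
Unshelve. all: by end_near. Qed.

(** Compared with r^(q-1) (1 + r^q)^-2, which behaves in the same way at 0 and has
the explicit primitive -(1/q) (1 + r^q)^-1. *)
Lemma L1_powRexp q p a : 0 < q -> 0 < p -> 0 < a ->
  L1 (fun r => r `^ (q - 1) * expR (- (p * r `^ a))).
Proof.
move=> q0 p0 a0.
pose g r := r `^ (q - 1) * (1 + r `^ q) `^ (- 2).
pose G r := - q^-1 * (1 + r `^ q) `^ (- 1).
have r1 r : 0 < 1 + r `^ q by rewrite (@lt_le_trans _ _ 1)// lerDl powR_ge0.
have [lg _] : L1 g /\ Int g = 0 - (- q^-1).
  apply: (@ge0_FTC_pos R G g (- q^-1) 0).
  - by rewrite /g; meas.
  - by move=> r r0; rewrite mulr_ge0 ?powR_ge0.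
  - move=> r r0; rewrite /G /g; derive_by ltac:(idtac).
    rewrite (_ : - 1 - 1 = - 2); last by ring.
    by field; rewrite gt_eqF.
  - by move=> r r0; rewrite /g; conti.
  - rewrite -[X in _ --> X]mulr1; apply: cvgMl_tmp.
    have -> : (fun r => (1 + r `^ q) `^ (- 1)) = (fun r => (1 + r `^ q)^-1).
      by apply/funext => r; rewrite powR_inv1// ltW.
    rewrite -[X in _ --> X]invr1; apply: cvgV; first exact: oner_neq0.
    rewrite -[X in _ --> X]addr0; apply: cvgD; first exact: cvg_cst.
    exact: powR_cvg0.
  - rewrite -[X in _ --> X](mulr0 (- q^-1)); apply: cvgMl_tmp.
    have -> : (fun r => (1 + r `^ q) `^ (- 1)) = (fun r => (1 + r `^ q)^-1).
      by apply/funext => r; rewrite powR_inv1// ltW.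
    apply/gtr0_cvgV0; first by apply: nearW => r; exact: r1.
    apply/cvgryPge => A; have /cvgryPge/(_ A) := powR_cvgy q0.
    by apply: filterS => r /le_trans; apply; rewrite lerDr.
(* The bound on r^(2q) exp(-p r^a) compensates (1 + r^q)^2 <= 2 (1 + r^(2q)). *)
have [C C0 HC] := powRexp_bounded (addr_ge0 (ltW q0) (ltW q0)) p0 a0.
apply: (L1_dom _ _ (L1Z (2 + 2 * C) lg)); first by meas.
move=> r r0; rewrite ger0_norm ?mulr_ge0 ?powR_ge0 ?expR_ge0// /g.
rewrite mulrCA ler_wpM2l ?powR_ge0//.
rewrite powRN ler_pdivlMr ?powR_gt0//.
have := HC r r0; rewrite powRD ?(gt_eqF r0) ?implybT//.
set y := r `^ q => H.
rewrite -[2]/(2%:R) powR_mulrn ?(ltW (r1 _))// -/y.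
have e1 : expR (- (p * r `^ a)) <= 1.
  by rewrite expR_le1 oppr_le0 mulr_ge0 ?powR_ge0 ?ltW.
have e0 : 0 <= expR (- (p * r `^ a)) by exact: expR_ge0.
have y0 : 0 <= y by exact: powR_ge0.
move: e1 e0 H; set e := expR _ => e1 e0 H.
have : (1 + y) ^+ 2 <= 2 * (1 + y * y) by have := sqr_ge0 (1 - y); lra.
by move=> /(ler_wpM2l e0) /le_trans; apply; lra.
Qed.

(** The substitute for Cauchy's theorem.  Let the derivative of [f t r] in the
parameter [t] be also the derivative in [r] of [H t r].  Differentiating under
the integral sign, the derivative of the integral is the difference of the limits
of [H t] at infinity and at 0, here 0 and the constant [L]. *)
Lemma Int_constant_rate (f df H : R -> R -> R) (G : R -> R) (u v L : R) :
  (forall t, u < t < v -> L1 (f t)) ->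
  (forall t, measurable_fun setT (df t)) ->
  (forall t r, u < t < v -> 0 < r -> is_derive t 1 (f ^~ r) (df t r)) ->
  (forall t r, u < t < v -> 0 < r -> is_derive r 1 (H t) (df t r)) ->
  (forall t r, u < t < v -> 0 < r -> {for r, continuous (df t)}) ->
  (forall r, 0 <= G r) -> L1 G ->
  (forall t r, u < t < v -> 0 < r -> `|df t r| <= G r) ->
  (forall t, u < t < v -> H t r @[r --> 0^'+] --> L) ->
  (forall t, u < t < v -> H t r @[r --> +oo] --> (0 : R)) ->
  forall s t, u < s -> s <= t -> t < v -> Int (f t) - Int (f s) = - L * (t - s).
Proof.
move=> Lf mdf dfE dHE cdf G0 lG dfG H0 Hy.
have dZ t : u < t < v -> is_derive t 1 (fun t => Int (f t)) (- L).
  move=> tuv.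
  have tI : `]u, v[%classic t by rewrite /= in_itv.
  have Lf' x : `]u, v[%classic x -> L1 (f x).
    by rewrite /= in_itv/=; exact: Lf.
  have d1 x y : `]u, v[%classic x -> `]0, +oo[%classic y -> derivable (f ^~ y) x 1.
    by rewrite /= !in_itv/= andbT => xuv y0; have [] := dfE x y xuv y0.
  have d1E x y : u < x < v -> 0 < y -> partial1of2 f x y = df x y.
    move=> xuv y0; rewrite partial1of2E; have dfE' := dfE x y xuv y0.
    exact: derive_val.
  have Gb x y : `]u, v[%classic x -> `]0, +oo[%classic y ->
      `|partial1of2 f x y| <= G y.
    rewrite /= !in_itv/= andbT => xuv y0; rewrite d1E//; exact: dfG.
  have dE := differentiation_under_integral mpos tI Lf' d1 G0 lG Gb.
  have dd := derivable_under_integral mpos tI Lf' d1 G0 lG Gb.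
  apply: DeriveDef; first exact: dd.
  rewrite -derive1E dE.
  transitivity (Int (df t)); first by apply: Int_ext => r r0; exact: d1E.
  rewrite -[RHS]sub0r; apply: (@FTC_pos R (H t) (df t) L 0 (mdf t)).
  - apply: (L1_dom _ _ lG) => // r r0; exact: dfG.
  - by move=> r r0; exact: dHE.
  - by move=> r r0; exact: cdf.
  - exact: H0.
  - exact: Hy.
move=> s t us; rewrite le_eqVlt => /predU1P[->|st] tv; first by rewrite !subrr mulr0.
have [||c _ ->//] := @MVT R (fun t => Int (f t)) (fun=> - L) s t st.
- move=> x; rewrite in_itv/= => /andP[sx xt]; apply: dZ.
  by rewrite (lt_trans us)// (lt_trans xt).
- apply: derivable_within_continuous => x; rewrite in_itv/= => /andP[sx xt].
  have xuv : u < x < v by rewrite (lt_le_trans us)//= (le_lt_trans xt).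
  by have [] := dZ x xuv.
Qed.

Lemma cvg0_dom (T : Type) (F : set_system T) (FF : Filter F) (f g : T -> R) :
  (\forall x \near F, `|f x| <= g x) -> g x @[x --> F] --> (0 : R) ->
  f x @[x --> F] --> (0 : R).
Proof.
move=> fg g0; apply: norm_cvg0.
apply: (squeeze_cvgr _ (cvg_cst 0) g0).
by apply: filterS fg => x fgx; rewrite normr_ge0.
Qed.

Lemma cos_ge_abs t s : `|t| <= s -> s <= pi -> cos s <= cos t.
Proof.
move=> ts spi; rewrite -(cos_norm t) leNgt ltr_cos -?leNgt//.
- by rewrite in_itv/= spi (le_trans _ ts).
- by rewrite in_itv/= normr_ge0 (le_trans ts).
Qed.

Lemma abs_sin_le x : `|sin x| <= `|x|.
Proof.
wlog x0 : x / 0 <= x.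
  move=> H; have [|/ltW x0] := leP 0 x; first exact: H.
  by rewrite -normrN -sinN -(normrN x); apply: H; rewrite oppr_ge0.
move: x0; rewrite le_eqVlt => /predU1P[<-|x0]; first by rewrite sin0.
have [c _] : exists2 c, c \in `]0, x[ & sin x - sin 0 = cos c * (x - 0).
  apply: MVT => //.
  by apply: continuous_subspaceT => y; exact: continuous_sin.
rewrite sin0 !subr0 => ->; rewrite normrM ler_piMl//; exact: cos_max.
Qed.

Let abs_lt_pihalf (t : R) : `|t| < pi / 2 -> - (pi / 2) < t < pi / 2.
Proof. by rewrite ltr_norml. Qed.

Lemma L1_powRexp_sin a q p (B : R -> R) : 0 < q -> 0 < p -> 0 < a ->
  measurable_fun setT B ->
  L1 (fun r => r `^ (q - 1) * expR (- (p * r `^ a)) * sin (B r)).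
Proof.
move=> q0 p0 a0 mB; apply: (L1_dom _ _ (L1_powRexp q0 p0 a0)).
  by apply: measurable_funM; [meas|exact: measurable_sin_comp].
move=> r r0; rewrite normrM ger0_norm ?mulr_ge0 ?powR_ge0 ?expR_ge0//.
by rewrite ler_piMr ?mulr_ge0 ?powR_ge0 ?expR_ge0// sin_max.
Qed.

(** The imaginary part of e^(iK) z^q exp(-p z^a) / r on the ray z = r e^(i t / a):
up to the constant phase, the form z^(q-1) exp(-p z^a) dz in polar coordinates. *)
Definition rot_kernel a q p K t r : R :=
  r `^ (q - 1) * expR (- (p * cos t * r `^ a)) * sin (K + q / a * t - p * sin t * r `^ a).

(** For the holomorphic function h(z) = e^(iK) z^q exp(-p z^a), the Cauchy-Riemann
equations give d/dt (h / r) = d/dr (i h / a) on z = r e^(i t / a); this is the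
imaginary part of i h / a. *)
Definition rot_primitive a q p K t r : R :=
  a^-1 * (r `^ q * expR (- (p * cos t * r `^ a)) *
   cos (K + q / a * t - p * sin t * r `^ a)).

(** Rotation of the ray.  For q > 0 the boundary value [L] vanishes and the
integral does not depend on the angle; for q = 0 the simple pole at the origin
makes it vary linearly. *)
Lemma Int_rot_kernel_rate a q p K L : 0 < a -> 0 <= q -> 0 < p ->
  (forall t, `|t| < pi / 2 -> L1 (rot_kernel a q p K t)) ->
  (forall t, `|t| < pi / 2 -> rot_primitive a q p K t r @[r --> 0^'+] --> (L : R)) ->
  forall t, `|t| < pi / 2 -> Int (rot_kernel a q p K t) = Int (rot_kernel a q p K 0) - L * t.
Proof.
move=> a0 q0 p0 Lk H0 t tpi.
(* On [-v, v] the decay rate p cos t stays away from 0, which gives a uniform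
   dominating function. *)
pose v : R := (`|t| + pi / 2) / 2.
have [tv vpi] : `|t| < v /\ v < pi / 2 by rewrite /v; split; lra.
have pi0 := pi_gt0 R.
have vt0 : 0 <= v by apply: ltW (le_lt_trans _ tv).
pose c := cos v.
have c0 : 0 < c by apply: cos_gt0_pihalf; apply: abs_lt_pihalf; rewrite ger0_norm.
have cv s : - v < s < v -> `|s| < pi / 2 /\ c <= cos s.
  rewrite -ltr_norml => sv; split; first exact: lt_trans vpi.
  by apply: cos_ge_abs; [exact: ltW|lra].
pose df s r := r `^ (q - 1) * expR (- (p * cos s * r `^ a)) *
  (p * sin s * r `^ a * sin (K + q / a * s - p * sin s * r `^ a) +
   (q / a - p * cos s * r `^ a) * cos (K + q / a * s - p * sin s * r `^ a)).
pose G r := q / a * (r `^ (q - 1) * expR (- (p * c * r `^ a))) +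
  2 * p * (r `^ (q + a - 1) * expR (- (p * c * r `^ a))).
have pc0 : 0 < p * c by rewrite mulr_gt0.
have powB r e : 0 < r -> r `^ (e - 1) = r `^ e / r.
  by move=> r0; rewrite powRB ?(gt_eqF r0) ?implybT// powRr1// ltW.
have key : forall s t0 : R, - v < s -> s <= t0 -> t0 < v ->
    Int (rot_kernel a q p K t0) - Int (rot_kernel a q p K s) = - L * (t0 - s).
  apply: (@Int_constant_rate (rot_kernel a q p K) df (rot_primitive a q p K) G (- v) v L).
  - by move=> s /cv[spi _]; exact: Lk.
  - by move=> s; rewrite /df; meas.
  - move=> s r _ r0; rewrite /rot_kernel /df.
    derive_by ltac:(idtac); ring.
  - move=> s r _ r0; rewrite /rot_primitive /df; derive_by ltac:(idtac).
    rewrite !powB//; field; by rewrite !gt_eqF.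
  - by move=> s r _ r0; rewrite /df; conti.
  - move=> r; rewrite /G addr_ge0// mulr_ge0 ?mulr_ge0 ?powR_ge0 ?expR_ge0//.
      by rewrite invr_ge0 ltW.
    exact: ltW.
  - apply: L1D; last by apply: L1Z; apply: L1_powRexp => //; exact: ltr_wpDl.
    move: q0; rewrite le_eqVlt => /predU1P[<-|q0]; last exact/L1Z/L1_powRexp.
    apply: (@L1_ext R (cst 0)); last exact: integrable0.
    by move=> x _; rewrite !mul0r.
  - move=> s r /cv[spi cs] r0; rewrite /df /G normrM.
    rewrite (ger0_norm (mulr_ge0 (powR_ge0 _ _) (expR_ge0 _))).
    set e := expR _; set E := expR _.
    have eE : e <= E.
      by rewrite ler_expR lerN2 ler_wpM2r ?powR_ge0// ler_pM2l.
    have -> : r `^ (q + a - 1) = r `^ (q - 1) * r `^ a.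
      by rewrite -powRD ?(gt_eqF r0) ?implybT//; congr (_ `^ _); ring.
    set x := r `^ (q - 1); set y := r `^ a.
    have x0 : 0 <= x by exact: powR_ge0.
    have y0 : 0 <= y by exact: powR_ge0.
    have qa0 : 0 <= q / a by exact: (divr_ge0 q0 (ltW a0)).
    rewrite [leRHS](_ : _ = x * E * (q / a + 2 * p * y)); last by ring.
    apply: ler_pM; rewrite ?mulr_ge0 ?expR_ge0//.
      by rewrite ler_wpM2l.
    set B := _ - _.
    have s1 := sin_max s; have c1 := cos_max s.
    have sB := sin_max B; have cB := cos_max B.
    have py0 : 0 <= p * y by rewrite mulr_ge0// ltW.
    apply: (le_trans (ler_normD _ _)).
    rewrite !normrM.
    have h1 : `|p| * `|sin s| * `|y| * `|sin B| <= p * y.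
      rewrite (gtr0_norm p0) (ger0_norm y0) -[leRHS]mulr1.
      rewrite ler_pM ?mulr_ge0 ?(ltW p0)// ler_wpM2r//.
      by rewrite ler_piMr// ltW.
    have h2 : `|q / a - p * cos s * y| * `|cos B| <= q / a + p * y.
      rewrite -[leRHS]mulr1 ler_pM//.
      apply: (le_trans (ler_normB _ _)); rewrite (ger0_norm qa0) lerD2l.
      rewrite !normrM (gtr0_norm p0) (ger0_norm y0).
      by rewrite ler_wpM2r// ler_piMr// ltW.
    by apply: (le_trans (lerD h1 h2)); lra.
  - by move=> s /cv[spi _]; exact: H0.
  - move=> s /cv[spi cs]; rewrite /rot_primitive.
    rewrite -[X in _ --> X](mulr0 a^-1); apply: cvgMl_tmp.
    have pcs0 : 0 < p * cos s by rewrite mulr_gt0// (lt_le_trans c0).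
    apply: cvg0_dom (powRexp_cvgy q0 pcs0 a0); apply: nearW => r.
    rewrite normrM (ger0_norm (mulr_ge0 (powR_ge0 _ _) (expR_ge0 _))).
    by rewrite ler_piMr ?mulr_ge0 ?powR_ge0 ?expR_ge0// cos_max.
have [tv1 tv2] : - v < t /\ t < v by apply/andP; rewrite -ltr_norml.
have v0 : 0 < v by rewrite (le_lt_trans _ tv).
have [t0|/ltW t0] := leP 0 t.
  by have := key 0 t _ t0 tv2; rewrite oppr_lt0 v0 => /(_ isT); lra.
by have := key t 0 tv1 t0 v0; lra.
Qed.

(** At angle 0 the phase [K] factors out. *)
Lemma Int_rot_kernel a q p K t : 0 < a -> 0 < q -> 0 < p -> `|t| < pi / 2 ->
  L1 (rot_kernel a q p K t) /\
  Int (rot_kernel a q p K t) = Int (fun r => r `^ (q - 1) * expR (- (p * r `^ a))) * sin K.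
Proof.
move=> a0 q0 p0 tpi.
have Lk s : `|s| < pi / 2 -> L1 (rot_kernel a q p K s).
  move=> spi; apply: L1_powRexp_sin => //; last by meas.
  by rewrite mulr_gt0// cos_gt0_pihalf// abs_lt_pihalf.
split; first exact: Lk.
rewrite (@Int_rot_kernel_rate a q p K 0) ?(ltW q0)//; last first.
  move=> s spi; rewrite /rot_primitive -[X in _ --> X](mulr0 a^-1); apply: cvgMl_tmp.
  apply: cvg0_dom (powR_cvg0 q0); near=> r.
  rewrite !normrM (ger0_norm (powR_ge0 _ _)) (ger0_norm (expR_ge0 _)) -[leRHS]mulr1.
  rewrite ler_pM ?mulr_ge0 ?powR_ge0 ?expR_ge0 ?cos_max// ler_piMr ?powR_ge0//.
  rewrite expR_le1 oppr_le0 !mulr_ge0 ?powR_ge0 ?(ltW p0)//.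
  by rewrite ltW// cos_gt0_pihalf// abs_lt_pihalf.
rewrite mul0r subr0 mulrC -IntZ; last exact: L1_powRexp.
apply: Int_ext => r _; rewrite /rot_kernel cos0 sin0 !(mulr0, mulr1) mul0r subr0 addr0.
by rewrite mulrC.
Unshelve. all: by end_near. Qed.

(** The case q = 0 of the rotation: the form is dz/z near the origin, where the
sector of angle t / a contributes its angle. *)
Lemma Int_rot_kernel_sin a p t : 0 < a -> 0 < p -> `|t| < pi / 2 ->
  L1 (fun r => r^-1 * expR (- (p * cos t * r `^ a)) * sin (p * sin t * r `^ a)) /\
  Int (fun r => r^-1 * expR (- (p * cos t * r `^ a)) * sin (p * sin t * r `^ a)) = t / a.
Proof.
move=> a0 p0 tpi.
have kE s r : 0 < r -> - rot_kernel a 0 p 0 s r =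
    r^-1 * expR (- (p * cos s * r `^ a)) * sin (p * sin s * r `^ a).
  move=> r0; rewrite /rot_kernel !mul0r !add0r powR_inv1 ?(ltW r0)// sinN.
  by rewrite mulrN opprK.
have Lk s : `|s| < pi / 2 -> L1 (rot_kernel a 0 p 0 s).
  move=> spi; have c0 : 0 < p * cos s.
    by rewrite mulr_gt0// cos_gt0_pihalf// abs_lt_pihalf.
  apply: (L1_dom _ _ (L1Z p (L1_powRexp a0 c0 a0))); first by rewrite /rot_kernel; meas.
  move=> r r0; rewrite -normrN kE// !normrM (gtr0_norm (expR_gt0 _)).
  rewrite normfV (gtr0_norm r0).
  have := abs_sin_le (p * sin s * r `^ a).
  have -> : r `^ (a - 1) = r^-1 * r `^ a.
    by rewrite -powR_inv1 ?(ltW r0)// -powRD ?(gt_eqF r0) ?implybT// addrC.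
  rewrite !normrM (gtr0_norm p0) (ger0_norm (powR_ge0 _ _)) => H.
  set e := expR _; set y := r `^ a in H *.
  rewrite [leRHS](_ : _ = r^-1 * e * (p * y)); last by ring.
  rewrite ler_wpM2l ?mulr_ge0 ?expR_ge0 ?invr_ge0 ?(ltW r0)//.
  apply: (le_trans H); rewrite ler_wpM2r ?powR_ge0//.
  by rewrite ler_piMr ?sin_max// ltW.
split.
  by apply: L1_ext (L1N (Lk t tpi)) => r r0; rewrite kE.
transitivity (- Int (rot_kernel a 0 p 0 t)).
  rewrite -mulN1r -IntZ; last exact: Lk.
  by apply: Int_ext => r r0; rewrite mulN1r kE.
rewrite (@Int_rot_kernel_rate a 0 p 0 a^-1)//; last first.
  move=> s spi; rewrite /rot_primitive.
  rewrite -[X in _ --> X]mulr1; apply: cvgMl_tmp.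
  rewrite (_ : (fun r => _) =
      (fun r => expR (- (p * cos s * r `^ a)) * cos (- (p * sin s * r `^ a)))); last first.
    by apply/funext => r; rewrite powRr0 mul1r !mul0r !add0r.
  have c0 (k : R) : k * r `^ a @[r --> 0^'+] --> (0 : R).
    by rewrite -[X in _ --> X](mulr0 k); apply: cvgMl_tmp; exact: powR_cvg0.
  have ch (h : R -> R) k : continuous h -> h (- (k * r `^ a)) @[r --> 0^'+] --> h 0.
    move=> /(_ 0) ch; have H : - (k * r `^ a) @[r --> 0^'+] --> (0 : R).
      by rewrite -[X in _ --> X]oppr0; apply: cvgN; exact: c0.
    exact: (cvg_comp _ _ H ch).
  rewrite -[X in _ --> X]mulr1; apply: cvgM.
    by rewrite -[X in _ --> X](@expR0 R); apply: ch; exact: continuous_expR.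
  by rewrite -[X in _ --> X](@cos0 R); apply: ch; exact: continuous_cos.
suff -> : Int (rot_kernel a 0 p 0 0) = 0 by rewrite sub0r opprK mulrC.
rewrite -[RHS](mul0r (Int (rot_kernel a 0 p 0 0))) -IntZ; last first.
  by apply: Lk; rewrite normr0 divr_gt0 ?pi_gt0.
apply: Int_ext => r r0; rewrite /rot_kernel sin0 !(mulr0, mul0r) subr0 !add0r sin0.
by rewrite mulr0.
Qed.

Lemma L1_powRexp1 s p : 0 < s -> 0 < p -> L1 (fun r => r `^ (s - 1) * expR (- (p * r))).
Proof.
move=> s0 p0; apply: L1_ext (L1_powRexp s0 p0 ltr01) => r r0.
by rewrite powRr1// ltW.
Qed.

(** The scaling r |-> p r, seen as another instance of [Int_constant_rate]: with
the factor t^s the integral does not depend on t. *)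
Lemma Int_powRexp_scale s p : 0 < s -> 0 < p ->
  Int (fun r => r `^ (s - 1) * expR (- (p * r))) = eulerGamma s * p `^ (- s).
Proof.
move=> s0 p0.
pose f t r := t `^ s * (r `^ (s - 1) * expR (- (t * r))).
pose df t r := s * t `^ (s - 1) * (r `^ (s - 1) * expR (- (t * r)))
   - t `^ s * (r `^ s * expR (- (t * r))).
pose H t r := t `^ (s - 1) * (r `^ s * expR (- (t * r))).
(* An open interval containing both p and 1. *)
pose u := Num.min p 1 / 2; pose v := Num.max p 1 + 1.
have [u0 up u1] : [/\ 0 < u, u < p & u < 1].
  by rewrite /u; case: (leP p 1) => ?; split; lra.
have [pv v1] : p < v /\ 1 < v.
  by rewrite /v; case: (leP p 1) => ?; split; lra.
pose G r := s * (v `^ s / u) * (r `^ (s - 1) * expR (- (u * r)))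
   + v `^ s * (r `^ s * expR (- (u * r))).
have v0 : 0 < v by exact: lt_trans v1.
have powB r e : 0 < r -> r `^ (e - 1) = r `^ e / r.
  by move=> r0; rewrite powRB ?(gt_eqF r0) ?implybT// powRr1// ltW.
have pos t : u < t < v -> 0 < t by move=> /andP[+ _]; exact: lt_trans.
have key0 : forall a b, u < a -> a <= b -> b < v -> Int (f b) - Int (f a) = - 0 * (b - a).
  apply: (@Int_constant_rate f df H G u v 0).
  - by move=> t /pos t0; apply: L1Z; exact: L1_powRexp1.
  - by move=> t; rewrite /df; meas.
  - move=> t r /pos t0 r0; rewrite /f /df; derive_by ltac:(idtac).
    by rewrite !powB//; field; rewrite !gt_eqF.
  - move=> t r /pos t0 r0; rewrite /H /df; derive_by ltac:(idtac).
    by rewrite !powB//; field; rewrite !gt_eqF.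
  - by move=> t r /pos t0 r0; rewrite /df; conti.
  - by move=> r; rewrite /G addr_ge0// !mulr_ge0 ?powR_ge0 ?expR_ge0 ?invr_ge0 ?ltW.
  - apply: L1D; apply: L1Z; first exact: L1_powRexp1.
    have := @L1_powRexp1 (s + 1) u; rewrite addrK; apply => //; exact: addr_gt0.
  - move=> t r tuv r0; have t0 := pos t tuv; move: tuv => /andP[ut tv].
    rewrite /df /G.
    have h1 : t `^ s <= v `^ s.
      by apply: ge0_ler_powR; rewrite ?nnegrE ltW.
    have h2 : t `^ (s - 1) <= v `^ s / u.
      rewrite powB// ler_pM ?powR_ge0 ?invr_ge0 ?(ltW t0)//.
      by rewrite lef_pV2 ?posrE// ltW.
    have h3 : expR (- (t * r)) <= expR (- (u * r)).
      by rewrite ler_expR lerN2 ler_wpM2r ?ltW.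
    have e0 := expR_ge0 (- (t * r)).
    have P0 := powR_ge0.
    apply: (le_trans (ler_normB _ _)).
    rewrite !normrM !(ger0_norm (P0 _ _ _)) (ger0_norm e0) (gtr0_norm s0).
    have h4 : r `^ (s - 1) * expR (- (t * r)) <= r `^ (s - 1) * expR (- (u * r)).
      by rewrite ler_wpM2l ?powR_ge0.
    have h5 : r `^ s * expR (- (t * r)) <= r `^ s * expR (- (u * r)).
      by rewrite ler_wpM2l ?powR_ge0.
    apply: lerD; apply: ler_pM; rewrite ?mulr_ge0 ?powR_ge0 ?(ltW s0)//.
    by rewrite ler_wpM2l// ltW.
  - move=> t tuv; have t0 := pos t tuv.
    rewrite /H -[X in _ --> X](mulr0 (t `^ (s - 1))); apply: cvgMl_tmp.
    apply: cvg0_dom (powR_cvg0 s0); near=> r.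
    rewrite normrM (ger0_norm (powR_ge0 _ _)) (ger0_norm (expR_ge0 _)).
    rewrite ler_piMr ?powR_ge0// expR_le1 oppr_le0 mulr_ge0 ?(ltW t0)//.
  - move=> t tuv; have t0 := pos t tuv.
    rewrite /H -[X in _ --> X](mulr0 (t `^ (s - 1))); apply: cvgMl_tmp.
    apply: cvg0_dom (powRexp_cvgy (ltW s0) t0 ltr01); near=> r.
    rewrite normrM (ger0_norm (powR_ge0 _ _)) (ger0_norm (expR_ge0 _)).
    by rewrite powRr1.
have key a b : u < a -> a <= b -> b < v -> Int (f b) = Int (f a).
  by move=> ua ab bv; apply: subr0_eq; rewrite (key0 a b)// oppr0 mul0r.
have E : Int (f p) = Int (f 1).
  have [p1|/ltW p1] := leP p 1.
    exact/esym/(key p 1).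
  exact: (key 1 p).
have -> : eulerGamma s = Int (f 1).
  apply: eq_Rintegral => r _; by rewrite /f powR1 !mul1r.
rewrite -E /f IntZ; last exact: L1_powRexp1.
have ps0 : p `^ s != 0 by rewrite gt_eqF// powR_gt0.
by rewrite powRN mulrAC divff// mul1r.
Unshelve. all: by end_near. Qed.

(** Euler's integral along a ray: the integral of x^(s-1) exp(-w x) is
Gamma(s) w^-s for w = p e^(i t) as well. *)
Lemma Int_gamma_rot s p t K : 0 < s -> 0 < p -> `|t| < pi / 2 ->
  L1 (fun x => x `^ (s - 1) * expR (- (p * cos t * x)) * sin (K - p * sin t * x)) /\
  Int (fun x => x `^ (s - 1) * expR (- (p * cos t * x)) * sin (K - p * sin t * x))
   = eulerGamma s * p `^ (- s) * sin (K - s * t).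
Proof.
move=> s0 p0 tpi; have [Lk Ik] := @Int_rot_kernel 1 s p (K - s * t) t ltr01 s0 p0 tpi.
have kE x : 0 < x -> rot_kernel 1 s p (K - s * t) t x =
    x `^ (s - 1) * expR (- (p * cos t * x)) * sin (K - p * sin t * x).
  by move=> x0; rewrite /rot_kernel powRr1 ?(ltW x0)// divr1 subrK.
split; first exact: L1_ext Lk.
transitivity (Int (rot_kernel 1 s p (K - s * t) t)).
  by apply/esym/Int_ext => r r0; exact: kE.
rewrite Ik; congr (_ * _); rewrite -(Int_powRexp_scale s0 p0).
by apply: Int_ext => r r0; rewrite powRr1// ltW.
Qed.
End PowExp.

(** * The Gamma function and the reflection formula *)

Section GammaFunction.
Context {R : realType}.
Implicit Types s t x p : R.

Lemma L1_eulerGamma s : 0 < s -> L1 (fun r : R => r `^ (s - 1) * expR (- r)).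
Proof.
by move=> s0; apply: L1_ext (L1_powRexp1 s0 ltr01) => r _; rewrite mul1r.
Qed.

Lemma eulerGammaS s : 0 < s -> eulerGamma (s + 1) = s * eulerGamma s.
Proof.
move=> s0; apply/eqP; rewrite eq_sym -subr_eq0; apply/eqP.
have L2 : L1 (fun r : R => r `^ s * expR (- r)).
  by have := L1_eulerGamma (addr_gt0 s0 ltr01); rewrite addrK.
pose f r : R := s * (r `^ (s - 1) * expR (- r)) - r `^ s * expR (- r).
transitivity (Int f).
  rewrite /f (IntB (L1Z s (L1_eulerGamma s0)) L2) (IntZ _ (L1_eulerGamma s0)).
  congr (_ - _); rewrite /eulerGamma.
  by apply: Int_ext => r _; rewrite addrK.
rewrite -[RHS](subrr 0); apply: (@FTC_pos R (fun r => r `^ s * expR (- r)) f 0 0).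
- by rewrite /f; meas.
- by apply: L1B => //; exact/L1Z/L1_eulerGamma.
- by move=> r r0; rewrite /f; derive_by ltac:(ring).
- by move=> r r0; rewrite /f; conti.
- apply: cvg0_dom (powR_cvg0 s0); near=> r.
  rewrite normrM (ger0_norm (powR_ge0 _ _)) (ger0_norm (expR_ge0 _)).
  by rewrite ler_piMr ?powR_ge0// expR_le1 oppr_le0.
- apply: cvg0_dom (powRexp_cvgy (ltW s0) ltr01 ltr01); near=> r.
  rewrite normrM (ger0_norm (powR_ge0 _ _)) (ger0_norm (expR_ge0 _)).
  by rewrite mul1r powRr1.
Unshelve. all: by end_near. Qed.

Lemma Int_exp_cos (a b : R) : 0 < a ->
  L1 (fun p => expR (- (a * p)) * cos (b * p)) /\
  Int (fun p => expR (- (a * p)) * cos (b * p)) = a / (a ^+ 2 + b ^+ 2).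
Proof.
move=> a0.
have L : L1 (fun p => expR (- (a * p)) * cos (b * p)).
  apply: (L1_dom _ _ (L1_powRexp1 ltr01 a0)); first by meas.
  move=> r r0; rewrite subrr powRr0 mul1r normrM (ger0_norm (expR_ge0 _)).
  by rewrite ler_piMr ?expR_ge0// cos_max.
split=> //.
have d0 : 0 < a ^+ 2 + b ^+ 2 by rewrite ltr_wpDr ?sqr_ge0// exprn_gt0.
pose F p := (a ^+ 2 + b ^+ 2)^-1 * (expR (- (a * p)) * (b * sin (b * p) - a * cos (b * p))).
rewrite (_ : a / _ = 0 - (a ^+ 2 + b ^+ 2)^-1 * (1 * (b * 0 - a * 1))); last by ring.
apply: (@FTC_pos R F) => //.
- by meas.
- by move=> r r0; rewrite /F; derive_by ltac:(field; rewrite gt_eqF).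
- by move=> r r0; conti.
- have cF : {for 0, continuous F} by rewrite /F; conti.
  rewrite (_ : _ * _ = F 0); first exact: cvg_at_right_filter.
  by rewrite /F !mulr0 oppr0 expR0 sin0 cos0 mulr0.
- rewrite -[X in _ --> X](mulr0 (a ^+ 2 + b ^+ 2)^-1); apply: cvgMl_tmp.
  have h := powRexp_cvgy (lexx 0) a0 ltr01.
  have hk : expR (- (a * r `^ 1)) * (`|b| + `|a|) @[r --> +oo] --> (0 : R).
    rewrite -[X in _ --> X](mul0r (`|b| + `|a|)); apply: cvgM; last exact: cvg_cst.
    by move: h; under eq_fun do rewrite powRr0 mul1r.
  apply: cvg0_dom hk; near=> r.
  rewrite normrM (ger0_norm (expR_ge0 _)) powRr1 ?ler_wpM2l ?expR_ge0//.
  apply: (le_trans (ler_normB _ _)); rewrite !normrM.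
  by apply: lerD; rewrite ler_piMr ?sin_max ?cos_max.
Unshelve. all: by end_near. Qed.

(** The real part of 1 / (e^(-i t) + x e^(i t)), which tends to pi times the
Dirac mass at x = 1 as t tends to pi/2. *)
Definition refl_kernel t x : R :=
  cos t * (1 + x) / ((1 + x) ^+ 2 * cos t ^+ 2 + (1 - x) ^+ 2 * sin t ^+ 2).

Let cos_gt0 t : `|t| < pi / 2 -> 0 < cos t.
Proof. by rewrite ltr_norml; exact: cos_gt0_pihalf. Qed.

(** Fubini's theorem for x^(s-1) exp(-p (e^(-i t) + x e^(i t))): the integral in
p is the kernel, the integral in x is a rotated Gamma integral, and the integral
in p of the latter is one more. *)
Lemma Int_refl_kernel s t : 0 < s < 1 -> `|t| < pi / 2 ->
  L1 (fun x => x `^ (s - 1) * refl_kernel t x) /\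
  Int (fun x => x `^ (s - 1) * refl_kernel t x) =
    eulerGamma s * eulerGamma (1 - s) * cos (t * (1 - 2 * s)).
Proof.
move=> /andP[s0 s1] tpi; have c0 := cos_gt0 tpi.
have s1' : 0 < 1 - s by rewrite subr_gt0.
pose f x p := x `^ (s - 1) * (expR (- (cos t * (1 + x) * p)) * cos (sin t * (1 - x) * p)).
pose f' x p := expR (- (p * cos t)) * (x `^ (s - 1) * expR (- (p * cos t * x)) *
  sin (p * sin t + pi / 2 - p * sin t * x)).
have ff' x p : f x p = f' x p.
  rewrite /f /f' -addrAC sinDpihalf.
  rewrite (_ : - (cos t * (1 + x) * p) = - (p * cos t) + - (p * cos t * x)); last by ring.
  rewrite expRD (_ : sin t * (1 - x) * p = p * sin t - p * sin t * x); last by ring.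
  by ring.
pose G p := eulerGamma s * cos t `^ (- s) * (p `^ (1 - s - 1) * expR (- (cos t * p))).
have Lfx p : 0 < p -> L1 (f ^~ p).
  move=> p0; have [L _] := Int_gamma_rot (p * sin t + pi / 2) s0 p0 tpi.
  by apply: L1_ext (L1Z (expR (- (p * cos t))) L) => x _; rewrite ff'.
have [|||||L E] := @Fubini_pos R f G.
- rewrite /f; meas.
- by apply: L1Z; exact: L1_powRexp1.
- move=> x x0; apply: L1Z.
  by have [] := Int_exp_cos (sin t * (1 - x)) (mulr_gt0 c0 (addr_gt0 ltr01 x0)).
- exact: Lfx.
- move=> p p0; have pc0 : 0 < p * cos t by exact: mulr_gt0.
  apply: (@le_trans _ _ (Int (fun x => expR (- (p * cos t)) *
      (x `^ (s - 1) * expR (- (p * cos t * x)))))).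
    apply: Int_le.
    + exact: (integrable_norm (Lfx p p0)).
    + by apply: L1Z; exact: L1_powRexp1.
    + move=> x x0; rewrite ff' /f' normrM (ger0_norm (expR_ge0 _)).
      rewrite ler_wpM2l ?expR_ge0// normrM ger0_norm ?mulr_ge0 ?powR_ge0 ?expR_ge0//.
      by rewrite ler_piMr ?mulr_ge0 ?powR_ge0 ?expR_ge0// sin_max.
  rewrite IntZ; last exact: L1_powRexp1.
  rewrite Int_powRexp_scale// powRM ?(ltW p0) ?(ltW c0)// /G.
  rewrite (_ : 1 - s - 1 = - s); last by ring.
  by rewrite (mulrC (cos t)) le_eqVlt; apply/orP; left; apply/eqP; ring.
have fE x : 0 < x -> Int (f x) = x `^ (s - 1) * refl_kernel t x.
  move=> x0; have [L' E'] := Int_exp_cos (sin t * (1 - x)) (mulr_gt0 c0 (addr_gt0 ltr01 x0)).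
  rewrite /f (IntZ _ L') E' /refl_kernel; congr (_ * (_ / _)); by ring.
split; first exact: L1_ext L.
transitivity (Int (fun x => Int (f x))); first by apply: Int_ext => x x0; rewrite fE.
rewrite E.
have tpi' : `|- t| < pi / 2 by rewrite normrN.
have [L' E'] := Int_gamma_rot (pi / 2 - s * t) s1' ltr01 tpi'.
transitivity (Int (fun p => eulerGamma s * (p `^ (1 - s - 1) *
   expR (- (1 * cos (- t) * p)) * sin (pi / 2 - s * t - 1 * sin (- t) * p)))).
  apply: Int_ext => p p0.
  have [L1' E1] := Int_gamma_rot (p * sin t + pi / 2) s0 p0 tpi.
  transitivity (Int (f' ^~ p)); first by apply: Int_ext => x _; rewrite ff'.
  rewrite /f' (IntZ _ L1') E1 cosN sinN (_ : 1 - s - 1 = - s); last by ring.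
  rewrite (_ : pi / 2 - s * t - 1 * - sin t * p = p * sin t + pi / 2 - s * t); last by ring.
  rewrite (_ : - (1 * cos t * p) = - (p * cos t)); last by ring.
  by ring.
rewrite (IntZ _ L') E' powR1 mulr1 mulrA; congr (_ * _).
by rewrite -sinDpihalf; congr sin; ring.
Qed.

(** At s = 1/2 and t = 0 the kernel is 1 / (1 + x), and x^(-1/2) / (1 + x) is the
derivative of 2 atan (sqrt x). *)
Lemma eulerGamma_half : eulerGamma (2^-1 : R) ^+ 2 = pi.
Proof.
have h01 : 0 < (2^-1 : R) < 1 by apply/andP; split; lra.
have t0 : `|0 : R| < pi / 2 by rewrite normr0 divr_gt0 ?pi_gt0.
have [_ E] := Int_refl_kernel h01 t0.
move: E; rewrite mul0r cos0 mulr1 (_ : 1 - 2^-1 = 2^-1); last by field.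
rewrite -expr2 => <-.
pose f x : R := x `^ (2^-1 - 1) * (1 + (x `^ 2^-1) * (x `^ 2^-1)) `^ (- 1).
pose F x : R := 2 * atan (x `^ 2^-1).
have f0 x : 0 < 1 + (x `^ 2^-1) * (x `^ 2^-1).
  by rewrite ltr_wpDr// mulr_ge0// powR_ge0.
rewrite -[RHS]subr0; have [||||||_ <-] := @ge0_FTC_pos R F f 0 pi.
- by rewrite /f; meas.
- by move=> x x0; rewrite mulr_ge0 ?powR_ge0.
- move=> x x0; rewrite /F /f.
  have d : is_derive x 1 (fun x => atan (x `^ 2^-1))
    ((1 + (x `^ 2^-1) ^+ 2)^-1 * (2^-1 * x `^ (2^-1 - 1))).
    apply: (@is_derive1_comp _ atan (fun x => x `^ 2^-1)).
    by have := is_derive1_powR (2^-1) x0.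
  rewrite powR_inv1 ?(ltW (f0 x))//; derive_by ltac:(idtac).
  by rewrite expr2; field; rewrite gt_eqF.
- by move=> x x0; rewrite /f; conti.
- rewrite /F -[X in _ --> X](mulr0 2); apply: cvgMl_tmp.
  rewrite -[X in _ --> X](@atan0 R); apply: (cvg_comp _ _ (powR_cvg0 _)) => //.
  exact: continuous_atan.
- rewrite /F (_ : pi = 2 * (pi / 2)); last by field.
  apply: cvgMl_tmp; apply: (cvg_comp _ _ (powR_cvgy _)) => //.
  exact: cvgy_atan.
apply: Int_ext => x x0; rewrite /f /refl_kernel cos0 sin0 expr1n expr0n/=.
rewrite mulr0 addr0 mulr1 mul1r; congr (_ * _).
rewrite powR_inv1 ?(ltW (f0 x))// -powRD ?(gt_eqF x0) ?implybT//.
have -> : 2^-1 + 2^-1 = 1 :> R by field.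
by rewrite powRr1 ?(ltW x0)//; field; rewrite gt_eqF// addr_gt0.
Qed.

(** With q = x^(-s/2) and z = x^(s-1/2), the first expression is q^2 (z-1)^2 and
the sum x^(s-1) + x^-s is q^2 (z^2+1).  The second inequality is thus
(z-1)^2 (1+x^2) <= 5 (x-1)^2 (z^2+1).  For x <= 2 it follows from |z-1| <= |x-1|,
which holds because the exponent of z is between 0 and 1; for x > 2, from
(z-1)^2 <= z^2+1 and 1+x^2 <= 5 (x-1)^2. *)
Let sq_bound s x : 2^-1 <= s -> s < 1 -> 0 < x ->
  0 <= x `^ (s - 1) + x `^ (- s) - 2 * x `^ (- 2^-1) /\
  (x `^ (s - 1) + x `^ (- s) - 2 * x `^ (- 2^-1)) * (1 + x ^+ 2) <=
  5 * (1 - x) ^+ 2 * (x `^ (s - 1) + x `^ (- s)).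
Proof.
move=> s2 s1 x0.
pose q := x `^ (- s / 2); pose z := x `^ (s - 2^-1).
have q0 : 0 < q by exact: powR_gt0.
have z0 : 0 < z by exact: powR_gt0.
have P u v : x `^ u * x `^ v = x `^ (u + v) by rewrite powRD ?(gt_eqF x0) ?implybT.
have -> : x `^ (s - 1) = q ^+ 2 * z ^+ 2.
  by rewrite !expr2 !P; congr (_ `^ _); field.
have -> : x `^ (- s) = q ^+ 2 by rewrite expr2 P; congr (_ `^ _); field.
have -> : x `^ (- 2^-1) = q ^+ 2 * z by rewrite expr2 !P; congr (_ `^ _); field.
have -> : q ^+ 2 * z ^+ 2 + q ^+ 2 - 2 * (q ^+ 2 * z) = q ^+ 2 * (z - 1) ^+ 2 by ring.
split; first by rewrite mulr_ge0 ?sqr_ge0.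
rewrite -mulrA (_ : 5 * _ * _ = q ^+ 2 * (5 * (1 - x) ^+ 2 * (z ^+ 2 + 1))); last by ring.
rewrite ler_wpM2l ?sqr_ge0//.
have [x2|x2] := leP x 2; last first.
  rewrite [leRHS]mulrC; apply: ler_pM; rewrite ?sqr_ge0 ?addr_ge0 ?sqr_ge0//; nra.
have zx : (z - 1) ^+ 2 <= (1 - x) ^+ 2.
  have [x1|x1] := leP 1 x.
    have z1 : 1 <= z.
      by rewrite /z -[leLHS](@powRr0 R x) ler_powR// subr_ge0.
    have zx : z <= x by apply: ler1_powR => //; lra.
    nra.
  have zx : x <= z by apply: ger1_powR; [rewrite x0 ltW|lra].
  have z1 : z <= 1.
    by rewrite /z -[leRHS](@powRr0 R x) ger_powR ?x0 ?(ltW x1)// subr_ge0.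
  nra.
have zz : 1 <= z ^+ 2 + 1 by rewrite lerDr sqr_ge0.
have xx : 1 + x ^+ 2 <= 5 by nra.
have a0 := sqr_ge0 (1 - x); have b0 := sqr_ge0 (z - 1).
nra.
Qed.

(** The integral of (x^(s-1) + x^-s - 2 x^(-1/2)) against the kernel of angle t is
2 (K cos(t(1-2s)) - pi).  It is nonnegative by [sq_bound].  Moreover the factor
(1-x)^2 in [sq_bound] cancels the concentration of the kernel at x = 1, which
leaves the factor cos t, times the kernel of angle pi/4: for that angle the
denominator is 1 + x^2. *)
Let refl_ineq s t : 2^-1 <= s -> s < 1 -> 0 < t < pi / 2 ->
  let K := eulerGamma s * eulerGamma (1 - s) in
  pi <= K * cos (t * (1 - 2 * s)) /\
  sin t ^+ 2 * (K * cos (t * (1 - 2 * s)) - pi) <=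
    5 / cos (pi / 4) * cos t * (K * cos (pi / 4 * (1 - 2 * s))).
Proof.
move=> s2 s1 /andP[t0 tpi] K.
have pi0 := pi_gt0 R.
have tpi' : `|t| < pi / 2 by rewrite ger0_norm// ltW.
have qpi : `|pi / 4 : R| < pi / 2 by rewrite ger0_norm; lra.
have s01 : 0 < s < 1 by rewrite s1 andbT; lra.
have s01' : 0 < 1 - s < 1 by apply/andP; split; lra.
have h01 : 0 < (2^-1 : R) < 1 by apply/andP; split; lra.
have c0 := cos_gt0 tpi'; have c4 := cos_gt0 qpi.
pose S x := x `^ (s - 1) + x `^ (- s).
have IS v : `|v| < pi / 2 -> L1 (fun x => S x * refl_kernel v x) /\
    Int (fun x => S x * refl_kernel v x) = 2 * (K * cos (v * (1 - 2 * s))).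
  move=> vpi; have [La Ia] := Int_refl_kernel s01 vpi.
  have [Lb Ib] := Int_refl_kernel s01' vpi.
  have E x : x `^ (s - 1) * refl_kernel v x + x `^ (1 - s - 1) * refl_kernel v x =
      S x * refl_kernel v x.
    by rewrite /S mulrDl; congr (_ + _ `^ _ * _); ring.
  split; first by apply: L1_ext (L1D La Lb) => x _; exact: E.
  transitivity (Int (fun x => x `^ (s - 1) * refl_kernel v x +
      x `^ (1 - s - 1) * refl_kernel v x)); first by apply: Int_ext => x _; rewrite E.
  rewrite (IntD La Lb) Ia Ib -/K.
  have -> : 1 - (1 - s) = s by ring.
  rewrite (mulrC _ (eulerGamma s)) -/K -[in X in _ + X]cosN.
  have -> : - (v * (1 - 2 * (1 - s))) = v * (1 - 2 * s) by ring.
  by ring.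
have [Lt It] := IS t tpi'; have [L4 I4] := IS (pi / 4) qpi.
have [Lh] := Int_refl_kernel h01 tpi'.
have -> : 1 - 2^-1 = 2^-1 :> R by field.
rewrite -expr2 eulerGamma_half divff// subrr mulr0 cos0 mulr1 => Ih.
pose D x := S x - 2 * x `^ (2^-1 - 1).
have LD : L1 (fun x => D x * refl_kernel t x).
  apply: L1_ext (L1B Lt (L1Z 2 Lh)) => x _.
  by rewrite /D; ring.
have ID : Int (fun x => D x * refl_kernel t x) = 2 * (K * cos (t * (1 - 2 * s)) - pi).
  transitivity (Int (fun x => S x * refl_kernel t x - 2 * (x `^ (2^-1 - 1) * refl_kernel t x))).
    by apply: Int_ext => x _; rewrite /D; ring.
  by rewrite (IntB Lt (L1Z 2 Lh)) It (IntZ 2 Lh) Ih; ring.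
have half : 2^-1 - 1 = - 2^-1 :> R by field.
have den0 x : 0 < x -> 0 < (1 + x) ^+ 2 * cos t ^+ 2 + (1 - x) ^+ 2 * sin t ^+ 2.
  move=> x0; have A : 0 < (1 + x) ^+ 2 * cos t ^+ 2.
    by rewrite mulr_gt0 ?exprn_gt0 ?addr_gt0.
  by rewrite (lt_le_trans A)// lerDl mulr_ge0 ?sqr_ge0.
split.
  have : 0 <= Int (fun x => D x * refl_kernel t x).
    apply: Int_ge0 => x x0; have [H _] := sq_bound s2 s1 x0.
    rewrite /D half mulr_ge0// /refl_kernel.
    by rewrite divr_ge0 ?(ltW (den0 x x0))// mulr_ge0 ?(ltW c0)// addr_ge0 ?(ltW x0).
  by rewrite ID; lra.
have : Int (fun x => sin t ^+ 2 * (D x * refl_kernel t x)) <=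
    Int (fun x => 5 / cos (pi / 4) * cos t * (S x * refl_kernel (pi / 4) x)).
  apply: Int_le; [exact: L1Z|exact: L1Z|move=> x x0].
  have [D0 H] := sq_bound s2 s1 x0.
  have c42 : cos (pi / 4) ^+ 2 = 2^-1 :> R.
    have := cos_mulr2n (pi / 4 : R).
    have -> : pi / 4 *+ 2 = pi / 2 :> R by rewrite mulr2n; field.
    by rewrite cos_pihalf; lra.
  have d4 : (1 + x) ^+ 2 * cos (pi / 4) ^+ 2 + (1 - x) ^+ 2 * sin (pi / 4) ^+ 2 = 1 + x ^+ 2.
    by rewrite sin2cos2 c42; field.
  have d := den0 x x0; rewrite /refl_kernel d4.
  move: d; set d := (X in 0 < X) => d0.
  have S0 : 0 <= S x by rewrite addr_ge0 ?powR_ge0.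
  have x20 : 0 < 1 + x ^+ 2 by rewrite ltr_wpDr ?sqr_ge0.
  rewrite (_ : sin t ^+ 2 * _ = cos t * (1 + x) * (sin t ^+ 2 * D x / d)); last by ring.
  rewrite [leRHS](_ : _ = cos t * (1 + x) * (5 * S x / (1 + x ^+ 2))); last first.
    by field; rewrite !gt_eqF.
  rewrite ler_wpM2l ?mulr_ge0 ?(ltW c0) ?addr_ge0 ?(ltW x0)//.
  rewrite ler_pdivrMr// [leRHS]mulrAC ler_pdivlMr//.
  have H' : sin t ^+ 2 * (D x * (1 + x ^+ 2)) <= sin t ^+ 2 * (5 * (1 - x) ^+ 2 * S x).
    by rewrite ler_wpM2l ?sqr_ge0// /D half.
  rewrite -mulrA (le_trans H')//.
  rewrite (_ : sin t ^+ 2 * _ = 5 * S x * ((1 - x) ^+ 2 * sin t ^+ 2)); last by ring.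
  rewrite ler_wpM2l ?mulr_ge0// /d lerDr mulr_ge0 ?sqr_ge0//.
by rewrite (IntZ _ LD) ID (IntZ _ L4) I4; lra.
Qed.

(** Both inequalities of [refl_ineq] pass to the limit t -> pi/2, where the right
side of the second one vanishes and cos(t(1-2s)) becomes sin(pi s). *)
Lemma eulerGamma_reflection s : 0 < s < 1 ->
  eulerGamma s * eulerGamma (1 - s) * sin (pi * s) = pi.
Proof.
have pi0 := pi_gt0 R.
wlog s2 : s / 2^-1 <= s => [H /andP[s0 s1]|/andP[s0 s1]].
  have [s2|s2] := leP 2^-1 s; first by apply: H => //; rewrite s0.
  have := H (1 - s); have -> : 1 - (1 - s) = s by ring.
  have -> : pi * (1 - s) = - (pi * s) + pi by ring.
  rewrite sinDpi sinN opprK [eulerGamma (1 - s) * _]mulrC; apply; first by lra.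
  by apply/andP; split; lra.
pose K := eulerGamma s * eulerGamma (1 - s).
pose M := 5 / cos (pi / 4) * (K * cos (pi / 4 * (1 - 2 * s))).
pose h1 t := K * cos (t * (1 - 2 * s)) - pi.
pose h2 t := M * cos t - sin t * sin t * (K * cos (t * (1 - 2 * s)) - pi).
have lim (h : R -> R) : {for pi / 2, continuous h} ->
    (forall t, 0 < t < pi / 2 -> 0 <= h t) -> 0 <= h (pi / 2).
  move=> ch h0; rewrite -oppr_le0.
  have := @cvgr_to_le _ (pi / 2 : R)^'- _ R (fun t => - h t) (- h (pi / 2)) 0.
  apply; first by apply: cvgN; exact: cvg_at_left_filter.
  near=> t; rewrite oppr_le0; apply: h0; apply/andP; split.
    by near: t; apply: nbhs_left_gt; rewrite divr_gt0.
  by near: t; exact: nbhs_left_lt.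
have E : cos (pi / 2 * (1 - 2 * s)) = sin (pi * s).
  by rewrite -cosBpihalf -cosN; congr cos; field.
have H1 : 0 <= h1 (pi / 2).
  apply: lim; first by rewrite /h1; conti.
  by move=> t tpi; have [+ _] := refl_ineq s2 s1 tpi; rewrite /h1 subr_ge0.
have H2 : 0 <= h2 (pi / 2).
  apply: lim; first by rewrite /h2; conti.
  move=> t tpi; have [_] := refl_ineq s2 s1 tpi; rewrite /h2 /M subr_ge0 -expr2.
  by rewrite [leRHS]mulrAC.
move: H1 H2; rewrite /h1 /h2 E cos_pihalf sin_pihalf -/K => H1 H2.
by apply/eqP; rewrite eq_le; apply/andP; split; lra.
Unshelve. all: by end_near. Qed.

Lemma eulerGamma1 : eulerGamma (1 : R) = 1.
Proof.
have [_ E] := Int_exp_cos 0 (@ltr01 R).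
transitivity (Int (fun p : R => expR (- (1 * p)) * cos (0 * p))).
  by apply: Int_ext => p _; rewrite subrr powRr0 mul0r cos0 !mul1r mulr1.
by rewrite E expr1n expr0n/= addr0 divr1.
Qed.

Lemma eulerGamma_neq0 x : 0 < x -> eulerGamma x != 0.
Proof.
move=> x0; have [n] : exists n : nat, x <= n.+1%:R.
  by exists (Num.truncn x); apply: ltW; exact: truncnS_gt.
have G1 : eulerGamma (1 : R) != 0 by rewrite eulerGamma1 oner_neq0.
elim: n x x0 => [|n IH] x x0 xn.
  move: xn; rewrite le_eqVlt => /predU1P[->//|x1].
  have := @eulerGamma_reflection x; rewrite x0 x1 => /(_ isT) E.
  apply/eqP => G0; have := pi_gt0 R; rewrite -E G0 !mul0r ltxx//.
have [x1|] := ltP x 1; first by apply: IH => //; rewrite (le_trans (ltW x1))// ler1n.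
rewrite le_eqVlt => /predU1P[<-//|x1].
have x10 : 0 < x - 1 by rewrite subr_gt0.
have := eulerGammaS x10; rewrite subrK => ->.
apply: mulf_neq0; first by rewrite gt_eqF.
by apply: IH => //; rewrite lerBlDr natr1.
Qed.

Lemma Gamma_gt0E x : 0 < x -> Gamma x = eulerGamma x.
Proof.
move=> x0; rewrite /Gamma.
have -> : Num.truncn (1 - x) = 0%N.
  by apply/eqP; rewrite -leqn0 truncn_le_nat; lra.
by rewrite big_ord0 divr1 addr0.
Qed.

(** Passing from x + 1 to x <= 0 lengthens the product in the definition of Gamma by
the factor x; this is also right at the poles, where both sides vanish. *)
Lemma invGammaS x : (Gamma x)^-1 = x * (Gamma (x + 1))^-1.
Proof.
have [x0|x0] := ltP 0 x.
  rewrite !Gamma_gt0E ?addr_gt0// eulerGammaS// invfM mulrA divff ?mul1r//.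
  by rewrite gt_eqF.
pose m := Num.truncn (- x).
have m2 : Num.truncn (1 - (x + 1)) = m by congr Num.truncn; ring.
have m1 : Num.truncn (1 - x) = m.+1.
  have nx0 : 0 <= - x by rewrite oppr_ge0.
  apply: truncn_def; have /andP[a b] := truncn_itv nx0.
  by rewrite -/m in a b; rewrite -!natr1 in b *; apply/andP; split; lra.
rewrite /Gamma m1 m2 !invf_div big_ord_recl/= addr0 mulrA; congr (_ * _ / eulerGamma _).
  by apply: eq_bigr => i _; rewrite /bump/= -natr1; ring.
by rewrite -natr1; ring.
Qed.

(** The right side is meaningful for every x < 1 and satisfies the same functional
equation as 1/Gamma, so the reflection formula extends from ]0, 1[ downwards. *)
Lemma invGamma_lt1 x : x < 1 -> (Gamma x)^-1 = sin (pi * x) * eulerGamma (1 - x) / pi.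
Proof.
have [n] : exists n : nat, - n%:R <= x.
  exists (Num.truncn (- x)).+1; rewrite lerNl; exact/ltW/truncnS_gt.
have pi0 := pi_gt0 R.
elim: n x => [|n IH] x.
  rewrite oppr0 le_eqVlt => /predU1P[<- _|x0 x1].
    by rewrite invGammaS !mul0r mulr0 sin0 !mul0r.
  rewrite Gamma_gt0E//; have x01 : 0 < x < 1 by rewrite x0.
  have E := eulerGamma_reflection x01.
  have G0 : eulerGamma x != 0.
    apply/eqP => G0; move: E; rewrite G0 !mul0r => E.
    by move: pi0; rewrite -E ltxx.
  apply: (mulfI G0); rewrite divff//.
  rewrite [RHS](_ : _ = eulerGamma x * eulerGamma (1 - x) * sin (pi * x) / pi); last by ring.
  by rewrite E divff// gt_eqF.
have [x0|x0 nx x1] := ltP x 0; last first.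
  by apply: IH => //; rewrite (le_trans _ x0)// oppr_le0.
rewrite -natr1 => nx x1; rewrite invGammaS IH; [|lra|lra].
have -> : 1 - x = - x + 1 by ring.
rewrite eulerGammaS ?oppr_gt0//.
have -> : pi * (x + 1) = pi * x + pi by ring.
have -> : 1 - (x + 1) = - x by ring.
by rewrite sinDpi; ring.
Qed.

End GammaFunction.

(** * Taylor remainders of the exponential on a ray *)

Section ExpRemainder.
Context {R : realType}.
Implicit Types (w k r x : R) (N : nat).

(** Real and imaginary parts of exp(z) - T_N(z) at z = r e^(i w), where T_N is the
Taylor polynomial with N terms. *)
Definition re_exp_rem w N r : R :=
  expR (r * cos w) * cos (r * sin w) - \sum_(j < N) r ^+ j / j`!%:R * cos (j%:R * w).

Definition im_exp_rem w N r : R :=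
  expR (r * cos w) * sin (r * sin w) - \sum_(j < N) r ^+ j / j`!%:R * sin (j%:R * w).

(** The imaginary part of e^(ik) (exp(z) - T_N(z)) at z = r e^(i w). *)
Definition exp_rem w N k r : R := re_exp_rem w N r * sin k + im_exp_rem w N r * cos k.

Lemma exp_rem0 w k r : exp_rem w 0 k r = expR (r * cos w) * sin (k + r * sin w).
Proof. by rewrite /exp_rem /re_exp_rem /im_exp_rem !big_ord0 sinD; ring. Qed.

Lemma exp_remS w N k r :
  exp_rem w N.+1 k r = exp_rem w N k r - r ^+ N / N`!%:R * sin (k + N%:R * w).
Proof. by rewrite /exp_rem /re_exp_rem /im_exp_rem !big_ord_recr/= sinD; ring. Qed.

Lemma exp_rem_rot w N k v r :
  exp_rem w N (k + v) r = cos v * exp_rem w N k r + sin v * exp_rem w N (k + pi / 2) r.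
Proof. by rewrite /exp_rem sinD cosD sinDpihalf cosDpihalf; ring. Qed.

Let is_derive_pow_fact N x :
  is_derive x 1 (fun r : R => r ^+ N.+1 / N.+1`!%:R) (x ^+ N / N`!%:R).
Proof.
have h : is_derive x 1 (fun r : R => r ^+ N.+1) (N.+1%:R * x ^+ N).
  elim: N => [|N IH]; first by rewrite expr0 mulr1; exact: is_derive_id_fun.
  rewrite (_ : (fun r => _) = (fun r => r * r ^+ N.+1)); last first.
    by apply/funext => r; rewrite exprS.
  by derive_by ltac:(rewrite -[N.+2%:R]natr1 exprS; ring).
derive_by ltac:(idtac).
by rewrite mulr0 add0r factS natrM invfM mulrACA mulVf ?pnatr_eq0// mul1r mulrC.
Qed.

Let rem_derive w N x :
  is_derive x 1 (fun r => re_exp_rem w N.+1 r)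
    (cos w * re_exp_rem w N x - sin w * im_exp_rem w N x) /\
  is_derive x 1 (fun r => im_exp_rem w N.+1 r)
    (sin w * re_exp_rem w N x + cos w * im_exp_rem w N x).
Proof.
elim: N => [|N [IH1 IH2]].
  split.
    rewrite (_ : (fun r => _) = (fun r => expR (r * cos w) * cos (r * sin w) - 1)).
      by derive_by ltac:(rewrite /re_exp_rem /im_exp_rem !big_ord0; ring).
    by apply/funext => r; rewrite /re_exp_rem big_ord1 mul0r cos0 mulr1 divr1.
  rewrite (_ : (fun r => _) = (fun r => expR (r * cos w) * sin (r * sin w))).
    by derive_by ltac:(rewrite /re_exp_rem /im_exp_rem !big_ord0; ring).
  by apply/funext => r; rewrite /im_exp_rem big_ord1 mul0r sin0 mulr0 subr0.
have dpow := is_derive_pow_fact N x.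
have E1 r : re_exp_rem w N.+2 r =
    re_exp_rem w N.+1 r - r ^+ N.+1 / N.+1`!%:R * cos (N.+1%:R * w).
  by rewrite /re_exp_rem [in LHS]big_ord_recr/= opprD addrA.
have E2 r : im_exp_rem w N.+2 r =
    im_exp_rem w N.+1 r - r ^+ N.+1 / N.+1`!%:R * sin (N.+1%:R * w).
  by rewrite /im_exp_rem [in LHS]big_ord_recr/= opprD addrA.
have F1 r : re_exp_rem w N.+1 r = re_exp_rem w N r - r ^+ N / N`!%:R * cos (N%:R * w).
  by rewrite /re_exp_rem [in LHS]big_ord_recr/= opprD addrA.
have F2 r : im_exp_rem w N.+1 r = im_exp_rem w N r - r ^+ N / N`!%:R * sin (N%:R * w).
  by rewrite /im_exp_rem [in LHS]big_ord_recr/= opprD addrA.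
have W : N.+1%:R * w = N%:R * w + w by rewrite -natr1 mulrDl mul1r.
split.
  rewrite (funext E1); derive_by ltac:(idtac).
  by rewrite F1 F2 W cosD; ring.
rewrite (funext E2); derive_by ltac:(idtac).
by rewrite F1 F2 W sinD; ring.
Qed.

(** The derivative of exp - T_(N+1) is exp - T_N, and differentiating along the
ray multiplies by e^(i w), which shifts the phase.  The variable phase contributes
a multiplication by i, a shift by pi/2. *)
Lemma is_derive_exp_rem w N (k : R -> R) dk x : is_derive x 1 k dk ->
  is_derive x 1 (fun r => exp_rem w N.+1 (k r) r)
    (exp_rem w N (k x + w) x + exp_rem w N.+1 (k x + pi / 2) x * dk).
Proof.
move=> d; have [d1 d2] := rem_derive w N x; rewrite /exp_rem.
have e1 : is_derive x 1 (fun r => sin (k r)) (cos (k x) * dk) by der.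
have e2 : is_derive x 1 (fun r => cos (k r)) (- sin (k x) * dk) by der.
derive_by ltac:(idtac).
by rewrite sinD cosD sinDpihalf cosDpihalf; ring.
Qed.

(** [is_derive_exp_rem] starts at order 1; in order to include order 0, the remainder
of order N is written as the one of order N+1 plus a monomial. *)
Lemma derivable_exp_rem w N (k : R -> R) (dk x : R) : is_derive x 1 k dk ->
  exists dt, is_derive x 1 (fun r => exp_rem w N (k r) r) dt.
Proof.
move=> d; have dT := is_derive_exp_rem w N d.
have dX : is_derive x 1 (fun r : R => r ^+ N) ('D_1 (fun r : R => r ^+ N) x).
  exact/derivableP/exprn_derivable.
rewrite (_ : (fun r => _) = (fun r => exp_rem w N.+1 (k r) r +
    r ^+ N * N`!%:R^-1 * sin (k r + N%:R * w))); last first.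
  by apply/funext => r; rewrite exp_remS subrK.
by eexists; der.
Qed.

Let le_derive (f g df dg : R -> R) x : 0 <= x ->
  (forall r, is_derive r 1 f (df r)) -> (forall r, is_derive r 1 g (dg r)) ->
  (forall r, 0 < r -> df r <= dg r) -> f 0 <= g 0 -> f x <= g x.
Proof.
rewrite le_eqVlt => /predU1P[<-//|x0] hf hg dfg fg0.
have [c + E] : exists2 c, c \in `]0, x[ &
    (fun r => g r - f r) x - (fun r => g r - f r) 0 = (dg c - df c) * (x - 0).
  apply: (@MVT R (fun r => g r - f r) (fun c => dg c - df c)) => //.
  by apply: continuous_subspaceT => r; have := hf r; have := hg r => dg' df'; conti.
rewrite in_itv/= => /andP[c0 _].
have : 0 <= (dg c - df c) * (x - 0) by rewrite subr0 mulr_ge0 ?(ltW x0)// subr_ge0 dfg.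
by rewrite -E; lra.
Qed.

(** On the half-plane Re z <= 0 the exponential is bounded by 1; integrating this
bound N times along the ray gives the bound for the remainder.  The lower bound is
the upper bound for the phase shifted by pi. *)
Lemma exp_rem_bound w N k r : cos w <= 0 -> 0 <= r -> `|exp_rem w N k r| <= r ^+ N / N`!%:R.
Proof.
move=> cw; elim: N k r => [|N IH] k r r0.
  rewrite exp_rem0 expr0 divr1 normrM (ger0_norm (expR_ge0 _)) -[leRHS]mulr1.
  by rewrite ler_pM ?expR_ge0 ?sin_max// expR_le1 mulr_ge0_le0.
have t0 v : exp_rem w N.+1 v 0 = 0.
  rewrite /exp_rem /re_exp_rem /im_exp_rem !big_ord_recl/= !big1; first last.
  - by move=> i _; rewrite expr0n/= !mul0r.
  - by move=> i _; rewrite expr0n/= !mul0r.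
  by rewrite !(mul0r, sin0, cos0, expR0, expr0, fact0, divr1, mulr1, mulr0, addr0, subrr).
have d v x : is_derive x 1 (fun r => exp_rem w N.+1 v r) (exp_rem w N (v + w) x).
  have := is_derive_exp_rem w N (is_derive_cst_fun v x).
  by rewrite mulr0 addr0.
have dpow := is_derive_pow_fact N.
have up v : exp_rem w N.+1 v r <= r ^+ N.+1 / N.+1`!%:R.
  apply: (le_derive r0 (d v) dpow).
    by move=> x x0; apply: le_trans (IH (v + w) x (ltW x0)); exact: ler_norm.
  by rewrite t0 expr0n/= mul0r.
rewrite ler_norml up andbT lerNl.
have -> : - exp_rem w N.+1 k r = exp_rem w N.+1 (k + pi) r; last exact: up.
by rewrite /exp_rem sinDpi cosDpi; ring.
Qed.

End ExpRemainder.

(** * Translation of the half-line *)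

Section Translation.
Context {R : realType}.
Local Notation mu := (@lebesgue_measure R).
Implicit Types (h : R -> R) (u : R).

Let shift u (x : measurableTypeR R) : measurableTypeR R := x + u.

Let mshift u : measurable_fun setT (shift u).
Proof. by rewrite /shift; apply: measurable_funD => //; exact: measurable_cst. Qed.

Let lebesgue_shift u (A : set (measurableTypeR R)) : measurable A ->
  mu A = pushforward mu (shift u) A.
Proof.
apply: (@lebesgue_measure_unique R (pushforward mu (shift u))) => _ [[a b] _ <-] /=.
rewrite /pushforward.
rewrite (_ : shift u @^-1` _ = [set` `]a - u, b - u]]); last first.
  by apply/seteqP; split=> x; rewrite /shift/= !in_itv/= ltrBlDr lerBrDr.
rewrite !lebesgue_measure_itv/= !lte_fin ltrD2r.
by case: ifP => // _; rewrite -!EFinB; congr (_%:E); ring.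
Qed.

(** Lebesgue measure equals its image under a translation, since the two agree on
intervals; the integral over a translated half-line is then an image integral. *)
Lemma shift_pos u h : L1 h ->
  mu.-integrable `]u, +oo[ (fun s => (h (s - u))%:E) /\
  (\int[mu]_(s in `]u, +oo[) (h (s - u))%:E = (Int h)%:E)%E.
Proof.
move=> lh.
pose D : set (measurableTypeR R) := `]u, +oo[%classic.
have mD : measurable D by exact: measurable_itv.
pose h0 := (EFin \o h) \_ `]0, +oo[.
pose f (s : measurableTypeR R) : \bar R := h0 (s - u).
have mh0 : measurable_fun setT h0.
  apply/(measurable_restrictT _ _).1; first exact: mpos.
  by have /integrableP[] := lh.
have mf : measurable_fun setT f.
  apply: (measurableT_comp mh0); apply: measurable_funB => //.
have pD : shift u @^-1` D = `]0, +oo[%classic.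
  by apply/seteqP; split=> x; rewrite /shift /D/= !in_itv/= !andbT ltrDr.
have fE x : `]0, +oo[%classic x -> f (shift u x) = (h x)%:E.
  by move=> x0; rewrite /f /shift addrK /h0 patchE mem_set.
have fE' s : D s -> f s = (h (s - u))%:E.
  rewrite /D/= in_itv/= andbT => us; rewrite /f /h0 patchE mem_set//=.
  by rewrite in_itv/= andbT subr_gt0.
have intf : mu.-integrable (shift u @^-1` D) (f \o shift u).
  rewrite pD; apply: (eq_integrable mpos) lh => x; rewrite inE => x0 /=.
  by rewrite fE.
have ip := integrable_pushforward (mshift u) mf intf mD.
have eqm (g : measurableTypeR R -> \bar R) :
    (\int[mu]_(s in D) g s = \int[pushforward mu (shift u)]_(s in D) g s)%E.
  by apply: eq_measure_integral => A mA _; exact: lebesgue_shift.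
have If : mu.-integrable D f.
  apply/integrableP; split; first exact: measurable_funTS.
  by rewrite eqm; have /integrableP[] := ip.
split.
  by apply: (eq_integrable mD) If => s; rewrite inE => Ds; exact: fE'.
transitivity (\int[mu]_(s in D) f s)%E.
  by apply: eq_integral => s; rewrite inE => Ds; rewrite fE'.
rewrite eqm (integral_pushforward (mshift u) mf intf mD) pD -IntE//.
by apply: eq_integral => x; rewrite inE => x0; rewrite /= fE.
Qed.

End Translation.

(** * The Wright function as an integral over a ray *)

Section WrightFunction.
Context {R : realType} (al th : R).
Context (al0 : 0 < al) (al1 : al < 1).
Context (thpi2 : @pi R / 2 < th) (thpi : th < @pi R) (alth : al * th < @pi R / 2).
Implicit Types (b y r p : R) (N M n : nat).

Let pi0 : 0 < @pi R.
Proof. exact: pi_gt0. Qed.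

Let abs_alth : `|al * th| < pi / 2.
Proof. have th0 : 0 <= th by apply: ltW (lt_trans _ thpi2); rewrite divr_gt0.
by rewrite ger0_norm// mulr_ge0 ?(ltW al0). Qed.

Let cos_alth_gt0 : 0 < cos (al * th).
Proof. by apply: cos_gt0_pihalf; move: abs_alth; rewrite ltr_norml. Qed.

Let abs_th_pi : `|th - pi| < pi / 2.
Proof.
have := thpi; have := thpi2; have := pi0.
by rewrite ltr_norml => *; apply/andP; split; lra.
Qed.

Let cos_th_pi : cos (th - pi) = - cos th.
Proof. by rewrite -[in RHS](subrK pi th) cosDpi opprK. Qed.

Let sin_th_pi : sin (th - pi) = - sin th.
Proof. by rewrite -[in RHS](subrK pi th) sinDpi opprK. Qed.

Let cos_th_lt0 : cos th < 0.
Proof.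
rewrite -oppr_gt0 -cos_th_pi; apply: cos_gt0_pihalf.
by move: abs_th_pi; rewrite ltr_norml.
Qed.

Definition wright_term b y n : R :=
  (- y) ^+ n / n`!%:R * (Gamma (- al * n%:R + b))^-1.

(** With z = r e^(i th), the imaginary part of
e^(i th) z^-b (exp(z) - T_N(z)) exp(-y z^al). *)
Definition ray_kernel N b y r : R :=
  r `^ (- b) * expR (- (y * cos (al * th) * r `^ al)) *
  exp_rem th N ((1 - b) * th - y * sin (al * th) * r `^ al) r.

(** The remainder of order N compensates N powers of 1/r at the origin, whence
integrability for b < N + 1. *)
Let ray_kernel_bound N b y r : 0 < r ->
  `|ray_kernel N b y r| <= N`!%:R^-1 *
     (r `^ (N%:R + 1 - b - 1) * expR (- (y * cos (al * th) * r `^ al))).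
Proof.
move=> r0; rewrite /ray_kernel normrM ger0_norm ?mulr_ge0 ?powR_ge0 ?expR_ge0//.
have -> : N%:R + 1 - b - 1 = - b + N%:R by ring.
rewrite powRD ?(gt_eqF r0) ?implybT// powR_mulrn ?(ltW r0)//.
rewrite [leRHS](_ : _ = r `^ (- b) * expR (- (y * cos (al * th) * r `^ al)) *
  (r ^+ N / N`!%:R)); last by ring.
by rewrite ler_wpM2l ?mulr_ge0 ?powR_ge0 ?expR_ge0// exp_rem_bound// ltW.
Qed.

Let measurable_ray_kernel N b y : measurable_fun setT (ray_kernel N b y).
Proof. by rewrite /ray_kernel /exp_rem /re_exp_rem /im_exp_rem; meas. Qed.

Lemma L1_ray_kernel N b y : 0 < y -> b < N%:R + 1 -> L1 (ray_kernel N b y).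
Proof.
move=> y0 bN; have q0 : 0 < N%:R + 1 - b by rewrite subr_gt0.
apply: (L1_dom _ _ (L1Z N`!%:R^-1 (L1_powRexp q0 (mulr_gt0 y0 cos_alth_gt0) al0))) => //.
by move=> r r0; exact: ray_kernel_bound.
Qed.

(** Consecutive kernels differ by the imaginary part of
e^(i th) z^(N-b) exp(-y z^al) / N!, whose integral can be rotated to the positive
real axis, where the integrand is real. *)
Let Int_ray_kernelS N b y : 0 < y -> b < N%:R + 1 ->
  Int (ray_kernel N.+1 b y) = Int (ray_kernel N b y).
Proof.
move=> y0 bN; have q0 : 0 < N%:R + 1 - b by rewrite subr_gt0.
have [Lk Ik] := Int_rot_kernel 0 al0 q0 y0 abs_alth.
rewrite sin0 mulr0 in Ik.
transitivity (Int (fun r => ray_kernel N b y r -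
    N`!%:R^-1 * rot_kernel al (N%:R + 1 - b) y 0 (al * th) r)).
  apply: Int_ext => r r0; rewrite /ray_kernel exp_remS /rot_kernel.
  have -> : N%:R + 1 - b - 1 = - b + N%:R by ring.
  rewrite powRD ?(gt_eqF r0) ?implybT// powR_mulrn ?(ltW r0)//.
  have -> : 0 + (N%:R + 1 - b) / al * (al * th) - y * sin (al * th) * r `^ al =
     (1 - b) * th - y * sin (al * th) * r `^ al + N%:R * th.
    by field; rewrite gt_eqF.
  by ring.
rewrite (IntB (L1_ray_kernel y0 bN) (L1Z _ Lk)) (IntZ _ Lk) Ik mulr0 subr0//.
Qed.

Lemma Int_ray_kernel_indep N M b y : 0 < y -> b < N%:R + 1 -> (N <= M)%N ->
  Int (ray_kernel M b y) = Int (ray_kernel N b y).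
Proof.
move=> y0 bN /subnKC <-; elim: (M - N)%N => [|m IH]; first by rewrite addn0.
rewrite addnS Int_ray_kernelS//; rewrite (lt_le_trans bN)// lerD2r ler_nat leq_addr//.
Qed.

(** Hankel's formula on the ray.  As cos th < 0, the angle th - pi is admissible
for [Int_gamma_rot], which evaluates the integral as
Gamma(1-b) sin((1-b) th - (1-b)(th - pi)) = Gamma(1-b) sin(pi b): the reflection
formula identifies it. *)
Lemma Int_invGamma b : b < 1 ->
  L1 (fun r => r `^ (- b) * expR (r * cos th) * sin ((1 - b) * th + r * sin th)) /\
  Int (fun r => r `^ (- b) * expR (r * cos th) * sin ((1 - b) * th + r * sin th)) =
    pi * (Gamma b)^-1.
Proof.
move=> b1; have s0 : 0 < 1 - b by rewrite subr_gt0.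
have [Lk Ik] := Int_gamma_rot ((1 - b) * th) s0 ltr01 abs_th_pi.
have E r : r `^ (1 - b - 1) * expR (- (1 * cos (th - pi) * r)) *
     sin ((1 - b) * th - 1 * sin (th - pi) * r) =
    r `^ (- b) * expR (r * cos th) * sin ((1 - b) * th + r * sin th).
  rewrite cos_th_pi sin_th_pi; congr (_ `^ _ * expR _ * sin _); ring.
split; first by apply: L1_ext Lk => r _; rewrite E.
rewrite invGamma_lt1// mulrCA divff ?gt_eqF// mulr1.
transitivity (Int (fun x => x `^ (1 - b - 1) * expR (- (1 * cos (th - pi) * x)) *
     sin ((1 - b) * th - 1 * sin (th - pi) * x))).
  by apply: Int_ext => r _; rewrite E.
rewrite Ik powR1 mulr1 mulrC; congr (_ * _).
have -> : (1 - b) * th - (1 - b) * (th - pi) = - (pi * b) + pi by ring.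
by rewrite sinDpi sinN opprK.
Qed.

Let sinD_natpi (x : R) n : sin (x + n%:R * pi) = (-1) ^+ n * sin x.
Proof.
elim: n => [|n IH]; first by rewrite mul0r addr0 mul1r.
by rewrite -natr1 mulrDl mul1r addrA sinDpi IH exprS; ring.
Qed.

(** For r beyond the point where y r^al = d r the linear term dominates; before,
monotonicity bounds the power by its value at that point. *)
Let powR_sublinear y d : 0 < y -> 0 < d ->
  exists C, forall r, 0 < r -> y * r `^ al <= d * r + C.
Proof.
move=> y0 d0; pose r0 := (y / d) `^ (1 - al)^-1.
have a1 : 0 < 1 - al by rewrite subr_gt0.
have yd : 0 < y / d by exact: divr_gt0.
exists (y * r0 `^ al) => r rp.
have [rr0|r0r] := leP r r0.
  apply: (@le_trans _ _ (y * r0 `^ al)); last by rewrite lerDr mulr_ge0 ?ltW.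
  rewrite ler_wpM2l ?(ltW y0)//; apply: ge0_ler_powR; rewrite ?nnegrE ?powR_ge0//.
    exact: ltW.
  exact: ltW.
apply: (@le_trans _ _ (d * r)); last by rewrite lerDl mulr_ge0 ?powR_ge0 ?ltW.
have h : y / d <= r `^ (1 - al).
  have -> : y / d = r0 `^ (1 - al).
    by rewrite /r0 -powRrM mulVf ?gt_eqF// powRr1// ltW.
  by apply: ge0_ler_powR; rewrite ?nnegrE ?powR_ge0 ?(ltW a1) ?(ltW rp) ?(ltW r0r).
have -> : d * r = d * r `^ (1 - al) * r `^ al.
  rewrite -mulrA -powRD ?(gt_eqF rp) ?implybT//.
  by rewrite subrK powRr1// ltW.
by rewrite ler_wpM2r ?powR_ge0// mulrC -ler_pdivrMr.
Qed.

Let pow_fact_le (x : R) n : 0 <= x -> x ^+ n / n`!%:R <= expR x.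
Proof.
move=> x0; case: n => [|n]; first by rewrite expr0 fact0 divr1 -expR0 ler_expR.
by apply: le_trans (expR_ge1Dxn n x0); rewrite lerDr.
Qed.

(** The argument of -z^al for z on the ray, so that exp(-y z^al) is an exponential
along the direction [om]. *)
Let om := al * th + pi.

(** Expanding exp(-y z^al) - T_M(-y z^al) and integrating exp(z) z^(al n - b) term
by term over the ray gives the tail of the Wright series.  The partial sums are
dominated: a remainder of exp at a point of modulus rho = y r^al in the left
half-plane is at most rho^M exp(rho), and exp(rho) is absorbed by exp(r cos th)
since al < 1. *)
Lemma ray_series M b y : 0 < y -> b < 1 + al * M%:R ->
  let k r := r `^ (- b) * expR (r * cos th) *
     exp_rem om M ((1 - b) * th + r * sin th) (y * r `^ al) in
  L1 k /\ \sum_(i < j) wright_term b y (M + i) @[j --> \oo] --> pi^-1 * Int k.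
Proof.
move=> y0 bM k.
have com : cos om <= 0 by rewrite /om cosDpi oppr_le0 ltW.
pose ka r := (1 - b) * th + r * sin th.
(* P j is the sum of the terms M <= n < M + j, as a difference of remainders;
   the n-th term brings the parameter mu = b - al n. *)
pose P j r := r `^ (- b) * expR (r * cos th) *
  (exp_rem om M (ka r) (y * r `^ al) - exp_rem om (M + j) (ka r) (y * r `^ al)).
pose mu i : R := - al * (M + i)%:R + b.
have mu1 i : mu i < 1.
  rewrite /mu natrD; have : 0 <= al * i%:R by rewrite mulr_ge0// ltW.
  by lra.
pose h i r := (- y) ^+ (M + i) / (M + i)`!%:R * (r `^ (- mu i) * expR (r * cos th) *
   sin ((1 - mu i) * th + r * sin th)).
have hL i : L1 (h i) by apply: L1Z; have [] := Int_invGamma (mu1 i).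
have Ph j r : 0 < r -> \sum_(i < j) h i r = P j r.
  move=> r0; rewrite /P; elim: j => [|j IH]; first by rewrite big_ord0 addn0 subrr mulr0.
  rewrite big_ord_recr/= IH addnS exp_remS /h.
  set n := (M + j)%N.
  have -> : ka r + n%:R * om = (1 - mu j) * th + r * sin th + n%:R * pi.
    by rewrite /ka /om /mu -/n; ring.
  rewrite sinD_natpi (_ : - mu j = - b + al * n%:R); last by rewrite /mu /n; ring.
  rewrite powRD ?(gt_eqF r0) ?implybT// powRrM powR_mulrn ?powR_ge0//.
  by rewrite -[- y]mulN1r !exprMn; ring.
have IP j : Int (P j) = pi * \sum_(i < j) wright_term b y (M + i).
  have [_ E] := L1_sum (fun i (_ : (i < j)%N) => hL i).
  transitivity (Int (fun r => \sum_(i < j) h i r)).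
    by apply: Int_ext => r r0; rewrite Ph.
  rewrite E mulr_sumr; apply: eq_bigr => i _.
  have [Lg Ig] := Int_invGamma (mu1 i).
  by rewrite /h (IntZ _ Lg) Ig /wright_term /mu; ring.
(* Half of the decay of exp(z) absorbs exp(rho), the other half ensures
   integrability. *)
pose d := - cos th / 2.
have d0 : 0 < d by rewrite divr_gt0// oppr_gt0.
have [C HC] := powR_sublinear y0 d0.
have q0 : 0 < 1 + al * M%:R - b by rewrite subr_gt0.
pose G r := 2 * y ^+ M * expR C * (r `^ (1 + al * M%:R - b - 1) * expR (- (d * r))).
have LG : L1 G by apply: L1Z; exact: L1_powRexp1.
have [||j r r0|r r0|Lk cvk] := @Int_dct R P k G _ _ LG _ _.
- by move=> j; rewrite /P /ka /exp_rem /re_exp_rem /im_exp_rem; meas.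
- by rewrite /k /exp_rem /re_exp_rem /im_exp_rem; meas.
- rewrite /P normrM ger0_norm ?mulr_ge0 ?powR_ge0 ?expR_ge0//.
  set rho := y * r `^ al.
  have rho0 : 0 <= rho by rewrite mulr_ge0 ?powR_ge0 ?ltW.
  have rM : rho ^+ M = y ^+ M * r `^ (al * M%:R).
    by rewrite exprMn powRrM powR_mulrn ?powR_ge0.
  have eM : 1 <= expR rho by rewrite -expR0 ler_expR.
  have t1 : `|exp_rem om M (ka r) rho| <= rho ^+ M * expR rho.
    apply: (le_trans (exp_rem_bound _ _ com rho0)); rewrite ler_wpM2l ?exprn_ge0//.
    by apply: le_trans eM; rewrite invf_le1 ?ltr0n ?fact_gt0// ler1n fact_gt0.
  have t2 : `|exp_rem om (M + j) (ka r) rho| <= rho ^+ M * expR rho.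
    apply: (le_trans (exp_rem_bound _ _ com rho0)).
    rewrite exprD -mulrA ler_wpM2l ?exprn_ge0//.
    apply: le_trans (pow_fact_le j rho0); rewrite ler_wpM2l ?exprn_ge0//.
    rewrite lef_pV2 ?posrE ?ltr0n ?fact_gt0// ler_nat; apply: leq_fact.
    exact: leq_addl.
  have t3 := le_trans (ler_normB _ _) (lerD t1 t2).
  have e2 : expR (r * cos th) * expR rho <= expR C * expR (- (d * r)).
    rewrite -!expRD ler_expR; have := HC r r0; rewrite -/rho /d; lra.
  apply: (@le_trans _ _ (r `^ (- b) * expR (r * cos th) *
      (rho ^+ M * expR rho + rho ^+ M * expR rho))).
    by rewrite ler_wpM2l ?mulr_ge0 ?powR_ge0 ?expR_ge0.
  rewrite /G (_ : 1 + al * M%:R - b - 1 = - b + al * M%:R); last by ring.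
  rewrite powRD ?(gt_eqF r0) ?implybT// rM.
  have w0 : 0 <= 2 * y ^+ M * r `^ (- b) * r `^ (al * M%:R).
    by rewrite !mulr_ge0 ?powR_ge0 ?exprn_ge0 ?ltW.
  by have := ler_wpM2l w0 e2; lra.
- rewrite /P /k -/(ka r); apply: cvgMl_tmp.
  rewrite -[X in _ --> X]subr0; apply: cvgB; first exact: cvg_cst.
  set rho := y * r `^ al.
  have rho0 : 0 <= rho by rewrite mulr_ge0 ?powR_ge0 ?ltW.
  have c1 := cvg_series_cvg_0 (is_cvg_series_exp_coeff rho).
  have c2 : rho ^+ (j + M) / (j + M)`!%:R @[j --> \oo] --> (0 : R).
    by rewrite (cvg_shiftn M (fun j => rho ^+ j / j`!%:R)); exact: c1.
  apply: cvg0_dom c2; apply: nearW => j; rewrite addnC; exact: exp_rem_bound.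
split=> //.
have -> : (fun j => \sum_(i < j) wright_term b y (M + i)) = (fun j => pi^-1 * Int (P j)).
  by apply/funext => j; rewrite IP mulrA mulVf ?mul1r// gt_eqF.
exact: cvgMl_tmp.
Qed.

(** For M = 0 nothing is subtracted on either side, so that the integrand of
[ray_series] is the ray kernel with N = 0. *)
Let cvg_wright_lt1 N b y : 0 < y -> b < 1 ->
  series (wright_term b y) @ \oo --> pi^-1 * Int (ray_kernel N b y).
Proof.
move=> y0 b1; have b0 : b < 0%:R + 1 by rewrite add0r.
have bM : b < 1 + al * 0%:R by rewrite mulr0 addr0.
have [_] := ray_series y0 bM.
rewrite (Int_ray_kernel_indep y0 b0 (leq0n N)).
rewrite (_ : (fun j => _) = series (wright_term b y)); last first.
  by apply/funext => j; rewrite seriesEord.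
set k := (fun r => _); suff -> : Int (ray_kernel 0 b y) = Int k by [].
apply: Int_ext => r r0.
rewrite /k /ray_kernel !exp_rem0 /om cosDpi sinDpi.
rewrite (_ : y * r `^ al * - cos (al * th) = - (y * cos (al * th) * r `^ al)); last by ring.
rewrite (_ : (1 - b) * th + r * sin th + y * r `^ al * - sin (al * th) =
  (1 - b) * th - y * sin (al * th) * r `^ al + r * sin th); last by ring.
by ring.
Qed.

(** [ray_series] with M = 1 gives the series without its first term 1/Gamma(1) = 1,
with 1 subtracted from exp(-y z^al) instead of exp(z).  The two integrands differ
by Im (exp(z) - exp(-y z^al)) / r, a Frullani integral: [Int_rot_kernel_sin]
gives pi - th for the first half and th for the second one, which add up to pi. *)
Let cvg_wright_1 y : 0 < y -> series (wright_term 1 y) @ \oo --> pi^-1 * Int (ray_kernel 1 1 y).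
Proof.
move=> y0; have bM : 1 < 1 + al * 1%:R by rewrite mulr1 ltrDl.
have [Lk cvk] := ray_series y0 bM; set k := (fun r => _) in Lk cvk.
have b2 : 1 < 1%:R + 1 :> R by rewrite ltrDl.
have LR := L1_ray_kernel y0 b2.
have [La Ia] := Int_rot_kernel_sin al0 y0 abs_alth.
have pth : `|pi - th| < pi / 2 by rewrite distrC.
have [Lb Ib] := Int_rot_kernel_sin (@ltr01 R) (@ltr01 R) pth.
set A := (fun r => _) in La Ia; set B := (fun r => _) in Lb Ib.
have E : Int (ray_kernel 1 1 y) - Int k = pi.
  rewrite -(IntB LR Lk).
  transitivity (Int (fun r => A r + B r)).
    apply: Int_ext => r r0.
    rewrite /k /A /B /ray_kernel !exp_remS !exp_rem0 /= expr0 fact0 divr1 !mul1r !mul0r !addr0.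
    rewrite subrr !mul0r !add0r /om cosDpi sinDpi powR_inv1 ?(ltW r0)//.
    rewrite powRr1 ?(ltW r0)//.
    have -> : cos (pi - th) = - cos th by rewrite addrC cosDpi cosN.
    have -> : sin (pi - th) = sin th by rewrite addrC sinDpi sinN opprK.
    rewrite (_ : y * r `^ al * - cos (al * th) = - (y * cos (al * th) * r `^ al)); last by ring.
    rewrite (_ : - (- cos th * r) = r * cos th); last by ring.
    rewrite (_ : r * sin th + y * r `^ al * - sin (al * th) =
      - (y * sin (al * th) * r `^ al) + r * sin th); last by ring.
    by rewrite sinN (mulrC (sin th)); ring.
  by rewrite (IntD La Lb) Ia Ib; field; rewrite gt_eqF.
rewrite -(cvg_shiftS (series (wright_term 1 y))).
rewrite (_ : (fun n => _) = (fun n => 1 + \sum_(i < n) wright_term 1 y (1 + i))); last first.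
  apply/funext => n; rewrite seriesEord/= big_ord_recl/=; congr (_ + _).
  rewrite /wright_term mulr0 add0r expr0 fact0 divr1 mul1r.
  by rewrite Gamma_gt0E// eulerGamma1 invr1.
have -> : pi^-1 * Int (ray_kernel 1 1 y) = 1 + pi^-1 * Int k.
  have -> : Int (ray_kernel 1 1 y) = pi + Int k by rewrite -E subrK.
  by rewrite mulrDr mulVf// gt_eqF.
by apply: cvgD => //; exact: cvg_cst.
Qed.

(** Termwise this is
(b-1) = (b - 1 - al n) + al n together with 1/Gamma(x) = x / Gamma(x+1); the factor
n cancels against n! and shifts the index of the last series. *)
Let wright_term_rec b y n : (b - 1) * series (wright_term b y) n.+1 =
  series (wright_term (b - 1) y) n.+1 - al * y * series (wright_term (b - al) y) n.
Proof.
have G (m : nat) : (Gamma (- al * m%:R + (b - 1)))^-1 =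
    (b - 1 - al * m%:R) * (Gamma (- al * m%:R + b))^-1.
  by rewrite invGammaS; congr (_ * (Gamma _)^-1); ring.
rewrite !seriesEord/=; elim: n => [|n IH].
  rewrite !big_ord1 !big_ord0 mulr0 subr0 /wright_term G.
  rewrite (_ : (ord0 : nat) = 0%N)//; ring.
rewrite big_ord_recr/= mulrDr IH [\sum_(k < n.+2) _]big_ord_recr/=.
rewrite [\sum_(k < n.+1) wright_term (b - al) y k]big_ord_recr/=.
rewrite /wright_term G.
have -> : - al * n%:R + (b - al) = - al * n.+1%:R + b by rewrite -natr1; ring.
have -> : (- y) ^+ n.+1 / n.+1`!%:R = - y * n.+1%:R^-1 * ((- y) ^+ n / n`!%:R).
  by rewrite exprS factS natrM invfM; ring.
have n0 : n.+1%:R * n.+1%:R^-1 = 1 :> R by rewrite divff// pnatr_eq0.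
set g := (Gamma _)^-1; set w := (- y) ^+ n / n`!%:R.
set S1 := \sum_(i < _) _; set S2 := \sum_(i < _) _.
have -> : (b - 1 - al * n.+1%:R) * g = (b - 1) * g - al * n.+1%:R * g by ring.
have -> : al * y * (S2 + w * g) = al * y * S2 + al * y * (n.+1%:R * n.+1%:R^-1) * w * g.
  by rewrite n0; ring.
by ring.
Qed.

(** Integration by parts: the derivative of the imaginary part of
z^(1-b) (exp(z) - T_(N+1)(z)) exp(-y z^al) along the ray is the combination of the
three kernels, and this function vanishes at 0 and at infinity. *)
Let ray_kernel_rec N b y : 0 < y -> b < N.+1%:R + 1 ->
  (b - 1) * Int (ray_kernel N.+1 b y) =
  Int (ray_kernel N (b - 1) y) - al * y * Int (ray_kernel N.+1 (b - al) y).
Proof.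
move=> y0 bN.
have L1' := L1_ray_kernel y0 bN.
have b1N : b - 1 < N%:R + 1 by move: bN; rewrite -natr1; lra.
have baN : b - al < N.+1%:R + 1 by rewrite (lt_trans _ bN)// ltrBlDr ltrDl.
have L2 := L1_ray_kernel y0 b1N; have L3 := L1_ray_kernel y0 baN.
pose f r := (1 - b) * ray_kernel N.+1 b y r + ray_kernel N (b - 1) y r -
  al * y * ray_kernel N.+1 (b - al) y r.
have Lf : L1 f by apply: L1B; [apply: L1D => //; exact: L1Z|exact: L1Z].
pose k r := (1 - b) * th - y * sin (al * th) * r `^ al.
pose F r := r `^ (1 - b) * (expR (- (y * cos (al * th) * r `^ al)) * exp_rem th N.+1 (k r) r).
have yc0 : 0 < y * cos (al * th) by rewrite mulr_gt0.
(* F is of order r^(1-b+N+1) at the origin. *)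
have q0 : 0 < 1 - b + N.+1%:R by move: bN; lra.
have Fb r : 0 < r -> `|F r| <=
    N.+1`!%:R^-1 * (r `^ (1 - b + N.+1%:R) * expR (- (y * cos (al * th) * r `^ al))).
  move=> r0; rewrite /F !normrM (ger0_norm (powR_ge0 _ _)) (ger0_norm (expR_ge0 _)).
  have -> : r `^ (1 - b + N.+1%:R) = r `^ (1 - b) * r ^+ N.+1.
    by rewrite powRD ?(gt_eqF r0) ?implybT// powR_mulrn// ltW.
  rewrite [leRHS](_ : _ = r `^ (1 - b) * (expR (- (y * cos (al * th) * r `^ al)) *
    (r ^+ N.+1 / N.+1`!%:R))); last by ring.
  by rewrite !ler_wpM2l ?powR_ge0 ?expR_ge0// exp_rem_bound// ltW.
have I0 : Int f = 0 - 0.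
  apply: (@FTC_pos R F f 0 0) => //.
  - by rewrite /f /ray_kernel /exp_rem /re_exp_rem /im_exp_rem; meas.
  - move=> r r0; rewrite /F.
    have dk : is_derive r 1 k (- (y * sin (al * th) * (al * r `^ (al - 1)))).
      by rewrite /k; derive_by ltac:(ring).
    have dt := is_derive_exp_rem th N dk.
    derive_by ltac:(idtac).
    rewrite /f /ray_kernel -/(k r).
    have -> : 1 - b - 1 = - b by ring.
    have -> : r `^ (1 - b) = r * r `^ (- b).
      by rewrite powRD ?(gt_eqF r0) ?implybT// powRr1// ltW.
    have -> : r `^ (- (b - 1)) = r * r `^ (- b).
      by rewrite opprB powRD ?(gt_eqF r0) ?implybT// powRr1// ltW.
    have -> : r `^ (- (b - al)) = r `^ al * r `^ (- b).
      by rewrite opprB powRD ?(gt_eqF r0) ?implybT.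
    have -> : r `^ (al - 1) = r `^ al / r.
      by rewrite powRB ?(gt_eqF r0) ?implybT// powRr1// ltW.
    have -> : (1 - (b - 1)) * th - y * sin (al * th) * r `^ al = k r + th.
      by rewrite /k; ring.
    have -> : (1 - (b - al)) * th - y * sin (al * th) * r `^ al = k r + al * th.
      by rewrite /k; ring.
    rewrite (exp_rem_rot th N.+1 (k r) (al * th)).
    by field; rewrite gt_eqF.
  - move=> r r0.
    have dt M c : exists dt, is_derive r 1
        (fun r => exp_rem th M ((1 - c) * th - y * sin (al * th) * r `^ al) r) dt.
      have [dk hk] : exists dk, is_derive r 1
          (fun r => (1 - c) * th - y * sin (al * th) * r `^ al) dk by eexists; der.
      exact: (derivable_exp_rem th M hk).
    have [d1 h1] := dt N.+1 b; have [d2 h2] := dt N (b - 1).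
    have [d3 h3] := dt N.+1 (b - al).
    by rewrite /f /ray_kernel; conti.
  - have h : N.+1`!%:R^-1 * r `^ (1 - b + N.+1%:R) @[r --> 0^'+] --> (0 : R).
      by rewrite -[X in _ --> X](mulr0 N.+1`!%:R^-1); apply: cvgMl_tmp; exact: powR_cvg0.
    apply: cvg0_dom h; near=> r; have r0 : 0 < r by near: r; exact: nbhs_right_gt.
    apply: (le_trans (Fb r r0)); rewrite ler_wpM2l// ler_piMr ?powR_ge0//.
    by rewrite expR_le1 oppr_le0 mulr_ge0 ?powR_ge0 ?(ltW yc0).
  - have h : N.+1`!%:R^-1 * (r `^ (1 - b + N.+1%:R) *
        expR (- (y * cos (al * th) * r `^ al))) @[r --> +oo] --> (0 : R).
      rewrite -[X in _ --> X](mulr0 N.+1`!%:R^-1); apply: cvgMl_tmp.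
      exact: powRexp_cvgy (ltW q0) yc0 al0.
    apply: cvg0_dom h; near=> r; apply: Fb; near: r; exact: nbhs_pinfty_gt.
move: I0; rewrite subrr (IntB (L1D (L1Z (1 - b) L1') L2) (L1Z (al * y) L3)).
rewrite (IntD (L1Z (1 - b) L1') L2) (IntZ (1 - b) L1') (IntZ (al * y) L3) => I0.
by apply/eqP; rewrite -subr_eq0 -[X in _ == X]oppr0 -I0; apply/eqP; ring.
Unshelve. all: by end_near. Qed.

(** Both b - 1 and b - al are at most b - al, so each use of the recursion lowers
by one the number of steps of length al needed to get below 1. *)
Lemma cvg_wright N b y : 0 < y -> b < N%:R + 1 ->
  series (wright_term b y) @ \oo --> pi^-1 * Int (ray_kernel N b y).
Proof.
move=> y0; have [n] : exists n : nat, b < 1 + n%:R * al.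
  exists (Num.truncn (b / al)).+1; rewrite -ltrBlDl -ltr_pdivrMr//.
  apply: lt_trans (truncnS_gt _); rewrite ltr_pM2r ?invr_gt0//.
  by rewrite ltrBlDr ltrDl.
elim: n N b => [|n IH] N b.
  by rewrite mul0r addr0 => b1 _; exact: cvg_wright_lt1.
rewrite -natr1 => bn bN.
have [b1|] := ltP b 1; first exact: cvg_wright_lt1.
rewrite le_eqVlt => /predU1P[b1|b1].
  rewrite -b1 in bN *; rewrite (@Int_ray_kernel_indep 1 N) ?ltrDl//; last first.
    by case: N bN => // ; rewrite add0r ltxx.
  exact: cvg_wright_1.
case: N bN => [|N] bN; first by move: bN b1; rewrite add0r => /lt_trans /[apply]; rewrite ltxx.
have h1 : b - 1 < 1 + n%:R * al by move: al1 bn => *; lra.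
have h2 : b - al < 1 + n%:R * al by move: bn => *; lra.
have h3 : b - 1 < N%:R + 1 by move: bN; rewrite -natr1; lra.
have h4 : b - al < N.+1%:R + 1 by rewrite (lt_trans _ bN)// ltrBlDr ltrDl.
have c1 := IH N _ h1 h3; have c2 := IH N.+1 _ h2 h4.
have b10 : b - 1 != 0 by rewrite subr_eq0 gt_eqF.
rewrite -(cvg_shiftS (series (wright_term b y))).
have -> : pi^-1 * Int (ray_kernel N.+1 b y) = (b - 1)^-1 *
    (pi^-1 * Int (ray_kernel N (b - 1) y) -
    al * y * (pi^-1 * Int (ray_kernel N.+1 (b - al) y))).
  apply: (mulfI b10); rewrite [RHS]mulrA divff// mul1r mulrCA ray_kernel_rec//; ring.
have -> : (fun n => series (wright_term b y) n.+1) = (fun n => (b - 1)^-1 *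
   (series (wright_term (b - 1) y) n.+1 - al * y * series (wright_term (b - al) y) n)).
  by apply/funext => m; rewrite -wright_term_rec mulrA mulVf ?mul1r.
apply: cvgMl_tmp; apply: cvgB; last exact: cvgMl_tmp.
by rewrite (cvg_shiftS (series (wright_term (b - 1) y))).
Qed.

(** The kernel depends on y only through exp(-y z^al).  By Fubini's theorem the
integral over v may be computed first: it is a Gamma integral at the complex
rate tau z^al, equal to Gamma(e) tau^-e z^(-al e), and multiplying by z^(-al e)
turns b into b + al e. *)
Lemma Int_frac_ray_kernel N b (e x tau : R) : 0 < e -> 0 < x -> 0 < tau ->
  b + al * e < N%:R + 1 ->
  L1 (fun v => v `^ (e - 1) * Int (ray_kernel N b ((x + v) * tau))) /\
  Int (fun v => v `^ (e - 1) * Int (ray_kernel N b ((x + v) * tau))) =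
    eulerGamma e * tau `^ (- e) * Int (ray_kernel N (b + al * e) (x * tau)).
Proof.
move=> e0 x0 tau0 beN.
pose c := cos (al * th); have c0 : 0 < c := cos_alth_gt0.
have bN : b < N%:R + 1 by apply: le_lt_trans beN; rewrite lerDl mulr_ge0// ltW.
have Lr v : 0 < v -> L1 (ray_kernel N b ((x + v) * tau)).
  by move=> v0; apply: L1_ray_kernel => //; rewrite mulr_gt0// addr_gt0.
pose f v r := v `^ (e - 1) * ray_kernel N b ((x + v) * tau) r.
pose K r := (1 - b) * th - x * tau * sin (al * th) * r `^ al.
pose E r := r `^ (- b) * expR (- (x * tau * c * r `^ al)).
pose h L r v := v `^ (e - 1) * expR (- (tau * r `^ al * c * v)) *
  sin (L - tau * r `^ al * sin (al * th) * v).
(* The phase of the kernel depends on v, the remainder does not: separating the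
   two leaves rotated Gamma integrands in v. *)
have fE v r : f v r = E r * re_exp_rem th N r * h (K r) r v +
    E r * im_exp_rem th N r * h (K r + pi / 2) r v.
  rewrite /f /ray_kernel /h /E /exp_rem -/c.
  have -> : (1 - b) * th - (x + v) * tau * sin (al * th) * r `^ al =
    K r - tau * r `^ al * sin (al * th) * v by rewrite /K; ring.
  have -> : K r + pi / 2 - tau * r `^ al * sin (al * th) * v =
    K r - tau * r `^ al * sin (al * th) * v + pi / 2 by ring.
  have -> : - ((x + v) * tau * c * r `^ al) =
    - (x * tau * c * r `^ al) + - (tau * r `^ al * c * v) by ring.
  by rewrite sinDpihalf expRD; ring.
have hI L r : 0 < r -> L1 (h L r) /\
    Int (h L r) = eulerGamma e * (tau * r `^ al) `^ (- e) * sin (L - e * (al * th)).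
  by move=> r0; apply: Int_gamma_rot => //; rewrite mulr_gt0// powR_gt0.
have pE r : 0 < r -> (tau * r `^ al) `^ (- e) = tau `^ (- e) * r `^ (- (al * e)).
  by move=> r0; rewrite powRM ?powR_ge0 ?(ltW tau0)// -powRrM mulrN.
have q0 : 0 < N%:R + 1 - (b + al * e) by rewrite subr_gt0.
have y0 : 0 < x * tau * c by rewrite !mulr_gt0.
pose C := N`!%:R^-1 * (eulerGamma e * (tau * c) `^ (- e)).
pose G r := C * (r `^ (N%:R + 1 - (b + al * e) - 1) * expR (- (x * tau * c * r `^ al))).
have Lf' r : 0 < r -> L1 (f ^~ r).
  move=> r0; have [l1 _] := hI (K r) r r0; have [l2 _] := hI (K r + pi / 2) r r0.
  by apply: L1_ext (L1D (L1Z (E r * re_exp_rem th N r) l1)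
    (L1Z (E r * im_exp_rem th N r) l2)) => v _.
have [|v v0|r r0|r r0|Lint Eint] := @Fubini_pos R f G _ (L1Z _ (L1_powRexp q0 y0 al0)).
- by rewrite /f /ray_kernel /exp_rem /re_exp_rem /im_exp_rem; meas.
- by apply: L1Z; exact: Lr.
- exact: Lf'.
- have p0 : 0 < tau * c * r `^ al by rewrite !mulr_gt0// powR_gt0.
  have Lb := L1_powRexp1 e0 p0; have Ib := Int_powRexp_scale e0 p0.
  set k := N`!%:R^-1 * (r `^ (N%:R + 1 - b - 1) * expR (- (x * tau * c * r `^ al))).
  have -> : G r = Int (fun v => k * (v `^ (e - 1) * expR (- (tau * c * r `^ al * v)))).
    rewrite (IntZ k Lb) Ib /G /C /k.
    rewrite (powRM (- e) (ltW (mulr_gt0 tau0 c0)) (powR_ge0 r al)) -powRrM mulrN.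
    have -> : N%:R + 1 - (b + al * e) - 1 = N%:R + 1 - b - 1 + - (al * e) by ring.
    by rewrite powRD ?(gt_eqF r0) ?implybT//; ring.
  apply: (Int_le (integrable_abse (Lf' r r0)) (L1Z k Lb)) => v v0.
  rewrite /f normrM (ger0_norm (powR_ge0 _ _)).
  apply: (le_trans (ler_wpM2l (powR_ge0 _ _) (ray_kernel_bound _ _ _ r0))).
  have -> : - ((x + v) * tau * cos (al * th) * r `^ al) =
    - (x * tau * c * r `^ al) + - (tau * c * r `^ al * v) by rewrite /c; ring.
  by rewrite expRD /k le_eqVlt; apply/orP; left; apply/eqP; ring.
have IfE v : 0 < v -> Int (f v) = v `^ (e - 1) * Int (ray_kernel N b ((x + v) * tau)).
  by move=> v0; exact: IntZ (Lr v v0).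
split; first by apply: L1_ext Lint => v v0; rewrite IfE.
rewrite -(Int_ext IfE) Eint -(IntZ _ (L1_ray_kernel (mulr_gt0 x0 tau0) beN)).
apply: Int_ext => r r0.
have [l1 i1] := hI (K r) r r0; have [l2 i2] := hI (K r + pi / 2) r r0.
have -> : Int (f ^~ r) = E r * re_exp_rem th N r * Int (h (K r) r) +
    E r * im_exp_rem th N r * Int (h (K r + pi / 2) r).
  by rewrite -(IntDZ _ _ l1 l2); apply: Int_ext => v _; exact: fE.
rewrite i1 i2 (pE r r0).
rewrite /ray_kernel /exp_rem -/c.
have -> : (1 - (b + al * e)) * th - x * tau * sin (al * th) * r `^ al =
  K r - e * (al * th) by rewrite /K; ring.
have -> : K r + pi / 2 - e * (al * th) = K r - e * (al * th) + pi / 2 by ring.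
have -> : r `^ (- (b + al * e)) = r `^ (- b) * r `^ (- (al * e)).
  by rewrite opprD powRD ?(gt_eqF r0) ?implybT.
by rewrite sinDpihalf /E; ring.
Qed.

Lemma Wright_ray_kernel N b y : 0 < y -> b < N%:R + 1 ->
  Wright (- al) b (- y) = pi^-1 * Int (ray_kernel N b y).
Proof. by move=> y0 bN; apply: cvg_lim => //; exact: cvg_wright. Qed.

End WrightFunction.

Theorem proposition4 (R : realType) (alpha beta eta : R)
    (halpha0 : 0 < alpha) (halpha1 : alpha < 1) (hbeta : 0 <= beta)
    (heta : 0 < eta) (t u : R) (ht : 0 < t) (hu : 0 < u) :
  (@lebesgue_measure R).-integrable `]u, +oo[
      (fun s : R => (g eta (s - u) * psi alpha beta t s)%:E) /\
  ((psi alpha (beta + alpha * eta) t u)%:E =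
    \int[@lebesgue_measure R]_(s in `]u, +oo[)
      (g eta (s - u) * psi alpha beta t s)%:E)%E.
Proof.
have pi0 := pi_gt0 R.
(* th is the midpoint of pi/2 and min(pi, pi/(2 alpha)), two numbers in the
   right order as alpha < 1. *)
pose m := Num.min pi (pi / 2 / alpha); pose th := (pi / 2 + m) / 2.
have m1 : m <= pi by rewrite ge_min lexx.
have m2 : alpha * m <= pi / 2.
  by rewrite mulrC -ler_pdivlMr// ge_min lexx orbT.
have m3 : pi / 2 < m.
  rewrite lt_min; apply/andP; split; first by lra.
  by rewrite ltr_pdivlMr// gtr_pMr// divr_gt0.
have th1 : pi / 2 < th by rewrite /th; lra.
have th2 : th < pi by rewrite /th; lra.
have th3 : alpha * th < pi / 2.
  apply: (@lt_le_trans _ _ (alpha * m)) => //.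
  by rewrite ltr_pM2l// /th; lra.
pose tau := t `^ (- alpha); have tau0 : 0 < tau by exact: powR_gt0.
have [N bN] : exists N : nat, beta + alpha * eta < N%:R + 1.
  by exists (Num.truncn (beta + alpha * eta)); rewrite natr1; exact: truncnS_gt.
have b0 : beta < N%:R + 1 by apply: le_lt_trans bN; rewrite lerDl mulr_ge0// ltW.
have psiE b x : 0 < x -> b < N%:R + 1 ->
    psi alpha b t x = t `^ (b - 1) * (pi^-1 * Int (ray_kernel alpha th N b (x * tau))).
  move=> x0 bN'; rewrite /psi mulNr.
  by rewrite (Wright_ray_kernel halpha0 halpha1 th1 th2 th3 (mulr_gt0 x0 tau0) bN').
have [L E] := Int_frac_ray_kernel halpha0 th1 th2 th3 heta hu tau0 bN.
have Geta := eulerGamma_neq0 heta.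
pose k := (eulerGamma eta)^-1 * (t `^ (beta - 1) * pi^-1).
pose h v := k * (v `^ (eta - 1) * Int (ray_kernel alpha th N beta ((u + v) * tau))).
have Lh : L1 h by exact: L1Z.
have hE s : u < s -> g eta (s - u) * psi alpha beta t s = h (s - u).
  move=> us; have s0 := lt_trans hu us.
  by rewrite /g Gamma_gt0E// psiE// /h /k (addrC u) subrK; ring.
have [Is Es] := shift_pos u Lh.
split.
  apply: eq_integrable Is; first exact: measurable_itv.
  by move=> s; rewrite inE/= in_itv/= andbT => us; rewrite hE.
transitivity (\int[@lebesgue_measure R]_(s in `]u, +oo[) (h (s - u))%:E)%E; last first.
  by apply: eq_integral => s; rewrite inE/= in_itv/= andbT => us; rewrite hE.
rewrite Es; congr (_%:E).
rewrite (IntZ k L) E psiE// /k /tau -powRrM mulrNN.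
have -> : t `^ (beta + alpha * eta - 1) = t `^ (beta - 1) * t `^ (alpha * eta).
  by rewrite -powRD ?(gt_eqF ht) ?implybT//; congr (_ `^ _); ring.
by rewrite -[LHS]mul1r -(mulVf Geta); ring.
Qed.
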